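(* Let $d\ge 1$ and let $P=\{p_1,\ldots,p_d\}$ and $Q=\{q_1,\ldots,q_d\}$ be finite posets with $d$ elements each, and set $P'=\{p_{d+1}\}\oplus P$ and $Q'=\{q_{d+1}\}\oplus Q$, where $p_{d+1}$ and $q_{d+1}$ are new elements. If $P$ and $Q$ possess a common linear extension, then $$\operatorname{vol}\bigl(\Omega(\mathcal{O}_P,\mathcal{C}_Q)\bigr)=\sum_{W\subset[d+1]}\frac{e(\Delta_W(P',Q'))}{(d+1)!},$$ where the sum is over all subsets $W$ of $[d+1]=\{1,\ldots,d+1\}$.
   Context: Linear extensions. A linear extension of a finite poset $P=\{p_1,\ldots,p_d\}$ is a permutation $\sigma=i_1i_2\cdots i_d$ of $[d]=\{1,\ldots,d\}$ such that $a<b$ whenever $p_{i_a}<p_{i_b}$ in $P$. Posets $P=\{p_1,\ldots,p_d\}$ and $Q=\{q_1,\ldots,q_d\}$ possess a common linear extension if some permutation of $[d]$ is a linear extension of both. For any finite poset $R$, $e(R)$ denotes the number of linear extensions of $R$. Ordinal sum. For (disjoint) finite posets $P$ and $Q$, $P\oplus Q$ is the poset on $P\cup Q$ with $s\le t$ if (a) $s,t\in P$ and $s\le t$ in $P$, or (b) $s,t\in Q$ and $s\le t$ in $Q$, or (c) $s\in P$ and $t\in Q$. Thus $P'=\{p_1,\ldots,p_{d+1}\}$ is $P$ with a new least element $p_{d+1}$, and similarly for $Q'=\{q_1,\ldots,q_{d+1}\}$. Induced subposets and $\Delta_W$. For $W\subset[d+1]$, $P'_W=\{p_i: i\in W\}$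 is the induced subposet, i.e. $p_i\le p_j$ in $P'_W$ if and only if $p_i\le p_j$ in $P'$; likewise $Q'_W=\{q_i:i\in W\}$. With $\overline{W}=[d+1]\setminus W$, set $\Delta_W(P',Q')=P'_W\oplus Q'_{\overline{W}}$, a poset with $d+1$ elements. Order polytope. $\mathcal{O}_P\subset\mathbb{R}^d$ is the set of $(x_1,\ldots,x_d)$ with $0\le x_i\le 1$ for $1\le i\le d$ and $x_i\ge x_j$ whenever $p_i\le p_j$ in $P$. Chain polytope. $\mathcal{C}_Q\subset\mathbb{R}^d$ is the set of $(x_1,\ldots,x_d)$ with $x_i\ge 0$ for $1\le i\le d$ and $x_{i_1}+\cdots+x_{i_k}\le 1$ for every maximal chain $q_{i_1}<\cdots<q_{i_k}$ of $Q$. For convex polytopes $\mathcal{P},\mathcal{Q}\subset\mathbb{R}^d$ of dimension $d$ with integer vertices, $\Omega(\mathcal{P},\mathcal{Q})=\operatorname{conv}\{(\mathcal{P}\times\{1\})\cup((-\mathcal{Q})\times\{-1\})\}\subset\mathbb{R}^{d+1}$, where $-\mathcal{Q}=\{-y:y\in\mathcal{Q}\}$. Here $\operatorname{vol}$ is the usual Euclidean volume in $\mathbb{R}^{d+1}$. *)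

(* Defs.v *)
From HB Require Import structures.
From mathcomp Require Import all_boot all_order all_algebra all_fingroup.
From mathcomp Require Import all_classical all_reals all_analysis.

Set Implicit Arguments.
Unset Strict Implicit.
Unset Printing Implicit Defensive.

Import Order.TTheory GRing.Theory Num.Theory.
Import numFieldNormedType.Exports.

(* The word i_1 ... i_d is the permutation s with s a = i_a. *)
Definition linear_extension d (disp : Order.disp_t) (P : finPOrderType disp)
    (p : 'I_d -> P) (s : 'S_d) : bool :=
  [forall a, forall b, (p (s a) < p (s b))%O ==> (a < b)%N].

Definition common_linear_extension d (dispP dispQ : Order.disp_t)
    (P : finPOrderType dispP) (Q : finPOrderType dispQ)
    (p : 'I_d -> P) (q : 'I_d -> Q) : Prop :=
  exists s : 'S_d, linear_extension p s /\ linear_extension q s.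

(* e(P): the count does not depend on the labelling of P; enum_val is used. *)
Definition num_linear_extensions (disp : Order.disp_t)
    (P : finPOrderType disp) : nat :=
  #|[set s : 'S_#|P| | linear_extension (fun i => enum_val i : P) s]|.

Definition osum_display (dispP dispQ : Order.disp_t) : Order.disp_t.
Proof. exact: Order.Disp tt tt. Qed.

Definition osum (P Q : Type) : Type := (P + Q)%type.

Section OrdinalSum.
Context (dispP dispQ : Order.disp_t).
Context (P : finPOrderType dispP) (Q : finPOrderType dispQ).

HB.instance Definition _ := Finite.on (osum P Q).

Definition osum_le (s t : osum P Q) : bool :=
  match s, t with
  | inl x, inl y => (x <= y)%O
  | inr x, inr y => (x <= y)%O
  | inl _, inr _ => true
  | inr _, inl _ => false
  end.

Fact osum_le_refl : reflexive osum_le.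
Proof. by case=> x /=. Qed.

Fact osum_le_anti : antisymmetric osum_le.
Proof. by move=> [x|x] [y|y] //= /le_anti ->. Qed.

Fact osum_le_trans : transitive osum_le.
Proof. by move=> [x|x] [y|y] [z|z] //=; exact: le_trans. Qed.

HB.instance Definition _ := Order.Le_isPOrder.Build
  (osum_display dispP dispQ) (osum P Q)
  osum_le_refl osum_le_anti osum_le_trans.

End OrdinalSum.

Definition subposet_display (disp : Order.disp_t) : Order.disp_t.
Proof. exact: Order.Disp tt tt. Qed.

Section InducedSubposet.
Context (disp : Order.disp_t) (P : finPOrderType disp) (A : {set P}).

Definition subposet : Type := {x : P | x \in A}.

HB.instance Definition _ := SubFinite.on subposet.
HB.instance Definition _ := [SubChoice_isSubPOrder of subposet by <:
  with subposet_display disp].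

End InducedSubposet.

(* {p_(d+1)} (+) P, the singleton being 'I_1. *)
Definition add_least (disp : Order.disp_t) (P : finPOrderType disp) :=
  osum 'I_1 P.

(* [d+1] is 'I_d.+1, the new index d+1 is ord_max, and an old index i : 'I_d
   is lift ord_max i, which has the same value. *)
Definition label_least d (disp : Order.disp_t) (P : finPOrderType disp)
    (p : 'I_d -> P) (i : 'I_d.+1) : add_least P :=
  if unlift ord_max i is Some j then inr (p j) else inl ord0.

Definition Delta n (dispP dispQ : Order.disp_t)
    (P : finPOrderType dispP) (Q : finPOrderType dispQ)
    (p : 'I_n -> P) (q : 'I_n -> Q) (W : {set 'I_n}) :
    finPOrderType (osum_display (subposet_display dispP)
                                (subposet_display dispQ)) :=
  osum (subposet [set p i | i in W]) (subposet [set q i | i in ~: W]).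

Local Open Scope classical_set_scope.
Local Open Scope ring_scope.

Section OrderAndChainPolytopes.
Context (R : realType) (d : nat) (disp : Order.disp_t) (P : finPOrderType disp).
Variable p : 'I_d -> P.

Definition order_polytope : set 'rV[R]_d :=
  [set x : 'rV[R]_d | (forall i, 0 <= x 0 i <= 1) /\
           (forall i j, (p i <= p j)%O -> x 0 j <= x 0 i)].

Definition is_chain (C : {set P}) : bool :=
  [forall x in C, forall y in C, (x >=< y)%O].

Definition chain_polytope : set 'rV[R]_d :=
  [set x : 'rV[R]_d | (forall i, 0 <= x 0 i) /\
           (forall C : {set P}, maxset is_chain C ->
              \sum_(i | p i \in C) x 0 i <= 1)].

End OrderAndChainPolytopes.

Arguments order_polytope R {d disp P} p.
Arguments chain_polytope R {d disp P} p.

Definition convex_hull (R : realType) (V : lmodType R) (A : set V) : set V :=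
  smallest (@convex_set R V) A.

Definition Omega (R : realType) d (A B : set 'rV[R]_d) : set 'rV[R]_(d + 1) :=
  convex_hull ([set row_mx x (const_mx 1) | x in A] `|`
               [set row_mx (- y) (const_mx (-1)) | y in B]).

(* Lebesgue measure on R^n, as the n-fold product of lebesgue_measure. *)
Section LebesgueTuple.
Context (R : realType).

Section Step.
Context (n : nat) (mu : {sigma_finite_measure set (n.-tuple R) -> \bar R}).

Definition cons_pair (xt : R * n.-tuple R) : n.+1.-tuple R :=
  [tuple of xt.1 :: xt.2].

Fact measurable_cons_pair : measurable_fun [set: R * n.-tuple R] cons_pair.
Proof.
by apply: measurable_cons; [exact: measurable_fst | exact: measurable_snd].
Qed.

Definition lebesgue_cons : set (n.+1.-tuple R) -> \bar R :=
  pushforward (@lebesgue_measure R \x mu)%E cons_pair.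

Let lebesgue_cons0 : lebesgue_cons set0 = 0%E.
Proof. by rewrite /lebesgue_cons /pushforward preimage_set0 measure0. Qed.

Let lebesgue_cons_ge0 A : (0 <= lebesgue_cons A)%E.
Proof. by rewrite /lebesgue_cons /pushforward measure_ge0. Qed.

Let lebesgue_cons_sigma_additive : semi_sigma_additive lebesgue_cons.
Proof.
exact: (@measure_semi_sigma_additive _ _ _
  (measure_function_pushforward__canonical__measure_function_Measure
     (@lebesgue_measure R \x mu)%E measurable_cons_pair)).
Qed.

HB.instance Definition _ := isMeasure.Build _ _ _ lebesgue_cons
  lebesgue_cons0 lebesgue_cons_ge0 lebesgue_cons_sigma_additive.

Let uncons (t : n.+1.-tuple R) : R * n.-tuple R :=
  (thead t, [tuple of behead t]).

Let measurable_uncons : measurable_fun setT uncons.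
Proof.
apply: measurable_fun_pair; first exact: measurable_tnth.
exact: measurable_behead.
Qed.

Let cons_pairK : cancel cons_pair uncons.
Proof.
by case=> x t; rewrite /uncons /cons_pair theadE; congr pair; exact/val_inj.
Qed.

Let lebesgue_cons_sigma_finite : sigma_finite setT lebesgue_cons.
Proof.
have /sigma_finiteP[F [TF ndF Foo]] := sigma_finiteT (@lebesgue_measure R).
have /sigma_finiteP[G [TG ndG Goo]] := sigma_finiteT mu.
exists (fun k => uncons @^-1` (F k `*` G k)).
  apply/esym; rewrite -subTset => t _.
  have : (\bigcup_i F i) (uncons t).1 by rewrite -TF.
  have : (\bigcup_i G i) (uncons t).2 by rewrite -TG.
  move=> [k _ Gt] [j _ Ft]; exists (maxn j k) => //; split.
    by move: Ft; exact/subsetPset/ndF/leq_maxl.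
  by move: Gt; exact/subsetPset/ndG/leq_maxr.
move=> k; have [mF Fk] := Foo k; have [mG Gk] := Goo k; split.
  rewrite -[X in measurable X]setTI; apply: measurable_uncons => //.
  exact: measurableX.
rewrite /lebesgue_cons /pushforward -comp_preimage.
rewrite (_ : uncons \o cons_pair = id); last exact/funext.
by rewrite preimage_id product_measure1E// lte_mul_pinfty// ge0_fin_numE.
Qed.

HB.instance Definition _ := Measure_isSigmaFinite.Build _ _ _ lebesgue_cons
  lebesgue_cons_sigma_finite.

End Step.

Fixpoint lebesgue_tuple (n : nat) :
    {sigma_finite_measure set (n.-tuple R) -> \bar R} :=
  match n with
  | 0 => \d_([tuple] : 0.-tuple R)
  | m.+1 => lebesgue_cons (lebesgue_tuple m)
  end.

Fact lebesgue_tuple_box n (A : 'I_n -> set R) :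
  (forall i, measurable (A i)) ->
  lebesgue_tuple n [set t | forall i, A i (tnth t i)] =
  (\prod_(i < n) @lebesgue_measure R (A i))%E.
Proof.
elim: n A => [|n IH] A mA.
  by rewrite big_ord0 /= diracE mem_set// => -[].
rewrite big_ord_recl -(IH (fun i => A (lift ord0 i)))//=.
rewrite -product_measure1E//; last first.
  rewrite (_ : [set t | _] = \bigcap_(i in [set: 'I_n])
     ((fun t : n.-tuple R => tnth t i) @^-1` A (lift ord0 i))); last first.
    by apply/seteqP; split=> t /= H i; [move=> _; exact: H | exact: (H i I)].
  apply: fin_bigcap_measurable => [|i _]; first exact: finite_finset.
  by rewrite -[X in measurable X]setTI; exact: measurable_tnth.
  exact: mA.
rewrite /lebesgue_cons /pushforward; congr (_ _).
apply/seteqP; split=> -[x t] /=.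
  move=> H; split; first exact: (H ord0).
  by move=> i; have := H (lift ord0 i); rewrite /cons_pair tnthS.
move=> [Hx Ht] i; case: (unliftP ord0 i) => [j ->|-> //].
by rewrite /cons_pair tnthS.
Qed.

End LebesgueTuple.

Definition vol (R : realType) n (A : set 'rV[R]_n) : \bar R :=
  lebesgue_tuple R n [set t : n.-tuple R | A (\row_i tnth t i)].

(* Main.v *)
Require Import Defs.
From HB Require Import structures.
From mathcomp Require Import all_boot all_order all_algebra all_fingroup.
From mathcomp Require Import all_classical all_reals all_analysis.
From mathcomp Require Import measurable_realfun ring lra.

Set Implicit Arguments.
Unset Strict Implicit.
Unset Printing Implicit Defensive.

Import Order.TTheory GRing.Theory Num.Theory.
Import numFieldNormedType.Exports.

Local Open Scope classical_set_scope.
Local Open Scope ring_scope.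

(** Write u = (1 - t) / 2 for the point (x, t). Every slice of the polytope at
height t is the Minkowski difference (1 - u) O_P - u C_Q. Since the chain
polytope is closed under decreasing nonnegative coordinates, x lies in this
slice exactly when x = k - l is solved by the smallest candidate for k, the
least nonnegative order-reversing function k above x: it must satisfy
k <= 1 - u, and its excess k - x must lie in u C_Q.

Let W be the set of peaks of x, the indices with x_i = k_i. A point with peak
set W is determined by its values on W and by the excesses off W, as
k_i = max (0, max {x_j : j in W, p_i <= p_j}). The values on W run over
(1 - u) O_(P_W), the excesses over the points of u C_(Q_W') with positive
coordinates, W' being the complement of W. Adding u to the values on W and
applying Stanley's transfer map to the excesses yields new coordinates z with
1 >= z_i >= u >= z_j > 0 for i in W and j in W', order-reversing on P_W and
strictly so on Q_W'. Up to a null set these points form the order polytope of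
the ordinal sum of P_W, a point, and Q_W', which is Delta_W(P', Q') when W is
read as a subset of [d+1] that does not contain d+1
(in_region_of_in_omega, in_omega_of_in_region, peaks_of_in_region).

The change of variables is triangular with diagonal entries 1, -1 and a single
-1/2, hence halves volumes (lebesgue_tuple_triangular, lebesgue_piece). The
order polytope of a poset on n elements is, up to a null set, a disjoint union
of congruent simplices of volume 1 / n!, one for each linear extension
(lebesgue_order_region). So the piece of the polytope with peak set W has
volume 2 e(Delta_W) / (d+1)!. One half of it is the term of W in the sum, and
the other half is the term of the union of W and {d+1}: moving the letter d+1
to the front of a linear extension shows that e takes the same value on both
(card_extensions_move). *)

(** * Measurable sets and finite families *)

Section FiniteFamilies.
Context (R : realType) (d : measure_display) (T : measurableType d).

Lemma measurable_preimageT d' (U : measurableType d') (f : T -> U) (A : set U) :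
  measurable_fun setT f -> measurable A -> measurable (f @^-1` A).
Proof. by move=> mf mA; rewrite -[X in measurable X]setTI; exact: mf. Qed.

Lemma measurable_pred (b : T -> bool) :
  measurable_fun setT b -> measurable [set x | b x].
Proof. by move=> mb; exact: (@measurable_preimageT _ _ b [set true]). Qed.

Lemma measurable_forall (I : finType) (F : I -> set T) :
  (forall i, measurable (F i)) -> measurable [set x | forall i, F i x].
Proof.
move=> mF; rewrite (_ : [set x | _] = \bigcap_(i in [set: I]) F i).
  by apply: fin_bigcap_measurable => // i _; exact: mF.
by apply/seteqP; split=> x /= H i; [move=> _; exact: H | exact: (H i Logic.I)].
Qed.

Lemma measurable_implies (b : bool) (F : set T) :
  measurable F -> measurable [set x | b -> F x].
Proof.
move=> mF; case: b.
  by rewrite (_ : [set x | _] = F)//; apply/seteqP; split=> x /= H; [exact: H|].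
by rewrite (_ : [set x | _] = setT)//; apply/seteqP; split=> x.
Qed.

Lemma measurable_bigmax0 (I : finType) (B : pred I) (F : I -> T -> R) :
  (forall i, measurable_fun setT (F i)) ->
  measurable_fun setT (fun x => \big[Num.max/0]_(i | B i) F i x).
Proof.
move=> mF; elim: (index_enum I) => [|i s IHs].
  by under eq_fun do rewrite big_nil; exact: measurable_cst.
under eq_fun do rewrite big_cons.
by case: (B i) => //; exact: measurable_maxr.
Qed.

Lemma measure_finType_disjoint (m : {measure set T -> \bar R}) (I : finType)
    (P : pred I) (F : I -> set T) :
  (forall i, P i -> measurable (F i)) ->
  (forall i j x, P i -> P j -> F i x -> F j x -> i = j) ->
  m [set x | exists2 i, P i & F i x] = (\sum_(i | P i) m (F i))%E.
Proof.
move=> mF dF; transitivity (m (\bigcup_(i in [set` P]) F i)); first by [].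
rewrite measure_fin_bigcup//; last first.
  by move=> i j /= Pi Pj [x [Fi Fj]]; exact: dF Fi Fj.
rewrite -(@bigfs _ _ _ _ (index_enum I))//; first exact: index_enum_uniq.
by move=> i _; rewrite mem_index_enum.
Qed.

Lemma negligible_finType (m : {measure set T -> \bar R}) (I : finType)
    (F : I -> set T) :
  (forall i, m.-negligible (F i)) ->
  m.-negligible [set x | exists i, F i x].
Proof.
move=> nF; rewrite (_ : [set x | _] = \big[setU/set0]_(i : I) F i).
  by elim/big_ind : _ => //; [exact: negligible_set0|exact: negligibleU].
rewrite -bigcup_pred; apply/seteqP; split=> x /=.
  by move=> [i Fi]; exists i.
by move=> [i _ Fi]; exists i.
Qed.

Lemma measure_diff_negligible (m : {measure set T -> \bar R}) (A B N : set T) :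
  measurable A -> measurable B -> m.-negligible N ->
  (forall x, ~ N x -> A x <-> B x) -> m A = m B.
Proof.
move=> mA mB [M [mM M0 NM]] AB.
rewrite (measureDI m mA mM) (measureDI m mB mM).
congr (m _ + _)%E.
  by apply/seteqP; split=> x [xA xM]; split=> //; apply/AB => // /NM.
have Z C : measurable C -> m (C `&` M) = 0%E.
  move=> mC; apply: subset_measure0 M0 => //; exact: measurableI.
by transitivity (0%E : \bar R); [exact: Z | exact: esym (Z _ _)].
Qed.

End FiniteFamilies.

(** * Lebesgue measure on tuples *)

Section LebesgueTupleTheory.
Context (R : realType).
Local Notation mu := (lebesgue_tuple R).
Local Notation leb := (@lebesgue_measure R).

Definition box n (A : 'I_n -> set R) : set (n.-tuple R) :=
  [set t | forall i, A i (tnth t i)].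

Lemma measurable_box n (A : 'I_n -> set R) :
  (forall i, measurable (A i)) -> measurable (box A).
Proof.
move=> mA; rewrite (_ : box A = \bigcap_(i in [set: 'I_n])
     ((fun t : n.-tuple R => tnth t i) @^-1` A i)); last first.
  by apply/seteqP; split=> t /= H i; [move=> _; exact: H | exact: (H i I)].
apply: fin_bigcap_measurable => [|i _]; first exact: finite_finset.
exact: measurable_preimageT (@measurable_tnth _ _ _ i) (mA i).
Qed.

(** Boxes are closed under intersection, generate the sigma-algebra, and the
cubes centred at the origin exhaust the space with finite measure. *)
Lemma lebesgue_tuple_unique n (m : {measure set (n.-tuple R) -> \bar R}) :
  (forall A : 'I_n -> set R, (forall i, measurable (A i)) ->
     m (box A) = (\prod_(i < n) leb (A i))%E) ->
  forall A, measurable A -> mu n A = m A.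
Proof.
move=> mE A mA.
pose G := [set B | exists2 F : 'I_n -> set R,
  (forall i, measurable (F i)) & B = box F].
pose g (k : nat) : set (n.-tuple R) := box (fun=> `[- k%:R, k%:R]%classic).
apply: (measure_unique G g) => //.
- apply/seteqP; split.
    apply: smallest_sub; first exact: smallest_sigma_algebra.
    move=> B; rewrite -bigcup_seq => -[i _ [Y mY <-]].
    apply: sub_sigma_algebra.
    exists (fun j => if j == i then Y else setT).
      by move=> j; case: ifP.
    apply/seteqP; split=> t /=.
      by move=> [_ Yt] j; case: eqP => [->|].
    by move=> /(_ i); rewrite eqxx.
  apply: smallest_sub; first exact: sigma_algebra_measurable.
  by move=> B [F mF ->]; exact: measurable_box.
- move=> _ _ [F mF ->] [H mH ->].
  exists (fun i => F i `&` H i); first by move=> i; exact: measurableI.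
  apply/seteqP; split=> t /=.
    by move=> [Ft Ht] i; split.
  by move=> FHt; split=> i; have [] := FHt i.
- by move=> k; exists (fun=> `[- k%:R, k%:R]%classic).
- rewrite -subTset => t _.
  (* the cube of half-side above the sum of the norms contains t *)
  pose M := \sum_(i < n) `|tnth t i|.
  exists (Num.truncn M).+1 => // i /=; rewrite in_itv /= -ler_norml.
  apply: le_trans (ltW (truncnS_gt M)).
  by rewrite /M (bigD1 i)//= lerDl sumr_ge0.
- move=> B [F mF ->]; rewrite mE//; exact: lebesgue_tuple_box.
- move=> k; rewrite [X in (X < _)%E]lebesgue_tuple_box//.
  pose I : set R := `[- k%:R, k%:R]%classic.
  suff /fineK <- : (\prod_(i < n) leb I)%E \is a fin_num.
    by rewrite ltry.
  elim/big_ind : _ => [//|x y|i _]; first exact: fin_numM.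
  by rewrite /= lebesgue_measure_itv /=; case: ifP => _.
Qed.

Definition permute n (s : 'S_n) (t : n.-tuple R) : n.-tuple R :=
  [tuple tnth t (s i) | i < n].

Lemma measurable_permute n (s : 'S_n) : measurable_fun setT (permute s).
Proof.
apply/measurable_fun_tnthP => i.
rewrite (_ : _ \o _ = fun t => tnth t (s i)); first exact: measurable_tnth.
by apply/funext => t /=; rewrite tnth_mktuple.
Qed.

Lemma lebesgue_tuple_permute n (s : 'S_n) A : measurable A ->
  mu n (permute s @^-1` A) = mu n A.
Proof.
move=> mA; have mp := measurable_permute s.
pose m : {measure set _ -> \bar R} :=
  measure_function_pushforward__canonical__measure_function_Measure (mu n) mp.
rewrite [RHS](@lebesgue_tuple_unique n m)// => F mF.
rewrite /m /= /pushforward.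
rewrite (_ : _ @^-1` _ = box (F \o (s^-1)%g)); last first.
  apply/seteqP; split=> t /= H i.
    by have := H ((s^-1)%g i); rewrite tnth_mktuple permKV.
  by rewrite tnth_mktuple; have := H (s i); rewrite /= permK.
rewrite [LHS]lebesgue_tuple_box; last by move=> i; exact: mF.
by rewrite [RHS](reindex_inj (@perm_inj _ (s^-1)%g)).
Qed.

Definition subst_tuple n (z : n.-tuple R) (i : 'I_n) (x : R) : n.-tuple R :=
  [tuple if j == i then x else tnth z j | j < n].

Lemma tnth_subst n (z : n.-tuple R) i x j :
  tnth (subst_tuple z i x) j = if j == i then x else tnth z j.
Proof. exact: tnth_mktuple. Qed.

Lemma measurable_cons_preimage n (A : set (n.+1.-tuple R)) : measurable A ->
  measurable (@cons_pair R n @^-1` A).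
Proof.
by apply: measurable_preimageT; exact: measurable_cons_pair.
Qed.

Lemma slice_ysection n (A : set (n.+1.-tuple R)) (t : n.-tuple R) :
  [set x | A (cons_pair (x, t))] = ysection (@cons_pair R n @^-1` A) t.
Proof. by apply/seteqP; split=> x /=; rewrite /ysection /= inE. Qed.

Lemma measurable_slice n (A : set (n.+1.-tuple R)) : measurable A ->
  measurable_fun setT
    (leb \o (fun t : n.-tuple R => [set x | A (cons_pair (x, t))])).
Proof.
move=> mA; rewrite (_ : (fun t => _) = ysection (@cons_pair R n @^-1` A)).
  by apply: measurable_fun_ysection; exact: measurable_cons_preimage.
by apply/funext => t; rewrite slice_ysection.
Qed.

Lemma lebesgue_tupleS n (A : set (n.+1.-tuple R)) : measurable A ->
  mu n.+1 A = (\int[mu n]_t leb [set x | A (cons_pair (x, t))])%E.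
Proof.
move=> mA; rewrite /= /lebesgue_cons /pushforward.
have mcA := measurable_cons_preimage mA.
rewrite (@product_measure_unique _ _ _ _ _ leb (mu n)
  (leb \x^ mu n)%E)//; last first.
  by move=> B C mB mC; exact: product_measure2E.
rewrite /product_measure2; apply: eq_integral => t _ /=.
by rewrite slice_ysection.
Qed.

(** Cavalieri's principle along one coordinate: the section of a set by a line
parallel to the i-th axis governs its measure. For the first coordinate this is
Fubini's theorem for the recursive definition of the measure, and the
invariance under permutations of the coordinates carries it to the others.
Shears and degenerate sets are treated with it. *)
Lemma lebesgue_tuple_cavalieri n (i : 'I_n) (c : R) (A B : set (n.-tuple R)) :
  0 <= c -> measurable A -> measurable B ->
  (forall z, leb [set x | A (subst_tuple z i x)] =
     (c%:E * leb [set x | B (subst_tuple z i x)])%E) ->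
  mu n A = (c%:E * mu n B)%E.
Proof.
case: n => [|n] in i A B *; first by case: i.
move=> c0 mA mB AB; pose s := tperm ord0 i.
have mp C : measurable C -> measurable (permute s @^-1` C).
  by apply: measurable_preimageT; exact: measurable_permute.
rewrite -(lebesgue_tuple_permute s mA) -(lebesgue_tuple_permute s mB).
rewrite !lebesgue_tupleS//; [|exact: mp|exact: mp].
have E (t : n.-tuple R) x : permute s (cons_pair (x, t)) =
    subst_tuple (permute s (cons_pair (0, t))) i x.
  apply/eq_from_tnth => j; rewrite tnth_subst !tnth_mktuple.
  case: eqP => [->|/eqP ji]; first by rewrite /s tpermR.
  have : s j != ord0 by rewrite -(tpermR ord0 i) (inj_eq perm_inj).
  by case: (unliftP ord0 (s j)) => [k ->|->]; rewrite ?tnthS ?eqxx.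
pose g t := leb [set x | (permute s @^-1` B) (cons_pair (x, t))].
have -> : (c%:E * \int[mu n]_t g t = \int[mu n]_t (c%:E * g t))%E.
  by rewrite ge0_integralZl//; exact: (measurable_slice (mp _ mB)).
apply: eq_integral => t _; rewrite /g /=; under eq_set do rewrite E.
by rewrite AB; under [in RHS]eq_set do rewrite E.
Qed.

Lemma measurable_subst n (z : n.-tuple R) i :
  measurable_fun setT (subst_tuple z i).
Proof.
apply/measurable_fun_tnthP => j.
pose g (x : R) : R := if j == i then x else tnth z j.
apply: (@eq_measurable_fun _ _ R R setT g).
  by move=> x _; exact: esym (tnth_subst z i x j).
by rewrite /g; case: (j == i); [exact: measurable_id | exact: measurable_cst].
Qed.

Lemma lebesgue_affine (c a : R) (B : set R) : c != 0 -> measurable B ->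
  leb [set x | B (c * x + a)] = (`|c|^-1%:E * leb B)%E.
Proof.
move=> c0 mB.
have mf : @measurable_fun _ _ (measurableTypeR R) (measurableTypeR R) setT
    (fun x : R => c * x + a).
  by apply: measurable_funD => //; apply: measurable_funM.
have nc : 0 < `|c| by rewrite normr_gt0.
pose m : {measure set (measurableTypeR R) -> \bar R} :=
  measure_function_pushforward__canonical__measure_function_Measure leb mf.
pose m' : {measure set (measurableTypeR R) -> \bar R} :=
  mscale (NngNum (normr_ge0 c)) m.
rewrite (@lebesgue_measure_unique _ m' _ B mB).
  rewrite /m' /= /mscale /= muleA -EFinM mulVf ?mul1e//.
  by rewrite gt_eqF.
move=> _ [[u v] _ <-] /=.
rewrite /m' /m /= /mscale /= /pushforward /=.
rewrite lebesgue_measure_itv/=.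
have [cp|cn|/eqP] := ltgtP c 0; last by rewrite (negbTE c0).
- rewrite (_ : _ @^-1` _ = `[(v - a) / c, (u - a) / c[%classic); last first.
    apply/seteqP; split => x /=; rewrite !in_itv /=.
      by rewrite ler_ndivrMr// ltr_ndivlMr// ltrBlDr lerBrDr mulrC andbC.
    by rewrite ler_ndivrMr// ltr_ndivlMr// ltrBlDr lerBrDr mulrC andbC.
  rewrite lebesgue_measure_itv/= !lte_fin ltr_nM2r ?invr_lt0// ltrD2r.
  case: ifP => _; last by rewrite mule0.
  rewrite -!EFinD -EFinM ltr0_norm//; congr (_%:E); field; exact: c0.
- rewrite (_ : _ @^-1` _ = `](u - a) / c, (v - a) / c]%classic); last first.
    apply/seteqP; split => x /=; rewrite !in_itv /=.
      by rewrite ler_pdivlMr// ltr_pdivrMr// ltrBlDr lerBrDr mulrC.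
    by rewrite ler_pdivlMr// ltr_pdivrMr// ltrBlDr lerBrDr mulrC.
  rewrite lebesgue_measure_itv/= !lte_fin ltr_pM2r ?invr_gt0// ltrD2r.
  case: ifP => _; last by rewrite mule0.
  rewrite -!EFinD -EFinM gtr0_norm//; congr (_%:E); field; exact: c0.
Qed.

Lemma lebesgue_tuple_null_slices n (i : 'I_n) (A : set (n.-tuple R)) :
  measurable A -> (forall z, leb [set x | A (subst_tuple z i x)] = 0%E) ->
  mu n A = 0%E.
Proof.
move=> mA A0; rewrite (@lebesgue_tuple_cavalieri n i 0 A A) ?mul0e// => z.
by rewrite mul0e A0.
Qed.

Definition shear n (i : 'I_n) (c : R) (f : n.-tuple R -> R) (z : n.-tuple R) :=
  subst_tuple z i (c * tnth z i + f z).

Lemma measurable_shear n (i : 'I_n) c f : measurable_fun setT f ->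
  measurable_fun setT (shear i c f).
Proof.
move=> mf; apply/measurable_fun_tnthP => j.
pose g z := if j == i then c * tnth z i + f z else tnth z j.
apply: (@eq_measurable_fun _ _ (n.-tuple R) R setT g).
  by move=> z _; exact: esym (tnth_subst z i _ j).
rewrite /g; case: (j == i); last exact: measurable_tnth.
apply: measurable_funD => //; apply: measurable_funM => //.
exact: measurable_tnth.
Qed.

Lemma lebesgue_tuple_shear n (i : 'I_n) c f A : c != 0 ->
  measurable_fun setT f -> (forall z x, f (subst_tuple z i x) = f z) ->
  measurable A ->
  mu n (shear i c f @^-1` A) = (`|c|^-1%:E * mu n A)%E.
Proof.
move=> c0 mf fi mA; apply: (@lebesgue_tuple_cavalieri _ i) => //.
  by apply: measurable_preimageT mA; exact: measurable_shear.
move=> z; rewrite -(@lebesgue_affine c (f z))//; last first.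
  by apply: measurable_preimageT mA; exact: measurable_subst.
congr (leb _); apply: eq_set => x; congr (A _).
apply/eq_from_tnth => j; rewrite /shear fi !tnth_subst eqxx.
by case: (j == i).
Qed.

Definition depends_below n (rk : 'I_n -> nat) (k : nat)
    (f : n.-tuple R -> R) :=
  forall z z' : n.-tuple R,
    (forall j, (rk j < k)%N -> tnth z j = tnth z' j) -> f z = f z'.

(** A nonlinear change of variables that is triangular, each coordinate being
rescaled and then shifted by a function of the coordinates of smaller rank,
scales volumes by the product of the diagonal entries. The shift of a
coordinate is expressed with the new values of the others: the coordinates
are updated one at a time, by increasing rank, and each update is a shear. *)
Lemma lebesgue_tuple_triangular n (rk : 'I_n -> nat) (c : 'I_n -> R)
    (f : 'I_n -> n.-tuple R -> R) :
  (forall i, c i != 0) -> (forall i, measurable_fun setT (f i)) ->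
  (forall i, depends_below rk (rk i) (f i)) ->
  exists G : n.-tuple R -> n.-tuple R,
    [/\ measurable_fun setT G,
        forall z i, tnth (G z) i = c i * tnth z i + f i (G z) &
        forall A, measurable A ->
          mu n (G @^-1` A) = ((\prod_i `|c i|^-1)%:E * mu n A)%E].
Proof.
move=> c0 mf depf.
suff Gl (l : seq 'I_n) : uniq l -> pairwise (relpre rk leq) l ->
  exists G : n.-tuple R -> n.-tuple R,
    [/\ measurable_fun setT G,
        forall z i, tnth (G z) i =
          if i \in l then c i * tnth z i + f i (G z) else tnth z i &
        forall A, measurable A ->
          mu n (G @^-1` A) = ((\prod_(i <- l) `|c i|^-1)%:E * mu n A)%E].
  pose l := sort (relpre rk leq) (enum 'I_n).
  have [||G [mG eG muG]] := Gl l.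
  - by rewrite sort_uniq enum_uniq.
  - rewrite -sorted_pairwise; last by move=> y x z; exact: leq_trans.
    by apply: sort_sorted => x y; exact: leq_total.
  exists G; split=> // [z i|A mA].
    by rewrite eG mem_sort mem_enum.
  rewrite muG//; congr (_%:E * _)%E.
  rewrite (perm_big (enum 'I_n)) /=; last by rewrite perm_sort.
  by rewrite big_enum.
(* The last entry of l has the largest rank, so its update does not disturb
   the equations already satisfied by the coordinates before it. *)
elim/last_ind: l => [_ _|l i IHl].
  exists id; split=> [|z i|A mA].
  - exact: measurable_id.
  - by rewrite in_nil.
  - by rewrite big_nil mul1e.
rewrite rcons_uniq => /andP[il ul]; rewrite pairwise_rcons => /andP[li pl].
have [G [mG eG muG]] := IHl ul pl.
have fi z x : f i (subst_tuple z i x) = f i z.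
  apply: depf => j; rewrite tnth_subst.
  by case: eqP => [->|//]; rewrite ltnn.
exists (shear i (c i) (f i) \o G); split=> [|z j|A mA].
- apply: measurableT_comp => //; exact: measurable_shear.
- rewrite /= mem_rcons inE {1}/shear tnth_subst.
  have [->|ji] /= := eqVneq j i.
    by rewrite eG (negbTE il) /shear fi.
  rewrite eG; case: ifP => // jl; congr (_ + _); apply: depf => k kj.
  rewrite tnth_subst; case: eqP => // ki.
  by move/allP: li => /(_ _ jl) /=; rewrite leqNgt -ki kj.
- rewrite comp_preimage muG; last first.
    by apply: measurable_preimageT mA; exact: measurable_shear.
  by rewrite lebesgue_tuple_shear// muleA -EFinM -cats1 big_cat big_seq1.
Qed.

End LebesgueTupleTheory.

(** * Regions cut out by orderings of the coordinates *)

Lemma card_perm_lt n (s : 'S_n) i : #|[set j | (s j < s i)%N]%SET| = s i.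
Proof.
rewrite (_ : [set j | _]%SET =
  s @^-1: [set k : 'I_n | (k < s i)%N]%SET); last first.
  by apply/setP => j; rewrite !inE.
rewrite card_preimset; last exact: perm_inj.
rewrite -sum1_card; under eq_bigl do rewrite inE.
by rewrite (big_ord_narrow (ltnW (ltn_ord (s i)))) sum1_card card_ord.
Qed.

(** Here s i is the position of i in the word, so s is the inverse of the
permutation that linear_extension speaks of. *)
Definition extensions n (r : rel 'I_n) : {set 'S_n} :=
  [set s : 'S_n | [forall i, forall j, r i j ==> (s i < s j)%N]]%SET.

Lemma extensionsP n (r : rel 'I_n) (s : 'S_n) :
  reflect (forall i j, r i j -> (s i < s j)%N) (s \in extensions r).
Proof.
rewrite inE; apply: (iffP forallP) => [rs i j|rs i].
  by have /forallP/(_ j)/implyP := rs i.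
by apply/forallP => j; apply/implyP; exact: rs.
Qed.

Section OrderSimplices.
Context (R : realType).
Local Notation mu := (lebesgue_tuple R).

(** The part of the unit cube where s i is the rank of the i-th coordinate,
ranks being counted from the largest value. Values 0 are left out so that
the simplices, together with a null set, partition the closed cube. *)
Definition order_simplex n (s : 'S_n) : set (n.-tuple R) :=
  [set z | (forall i, 0 < tnth z i <= 1) /\
           (forall i j, (s i < s j)%N -> tnth z j < tnth z i)].

Lemma measurable_order_simplex n (s : 'S_n) : measurable (order_simplex s).
Proof.
apply: measurableI.
  apply: measurable_forall => i; apply: measurable_pred.
  apply: measurable_and.
    by apply: measurable_fun_ltr => //; exact: measurable_tnth.
  by apply: measurable_fun_ler => //; exact: measurable_tnth.
apply: measurable_forall => i; apply: measurable_forall => j.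
apply: measurable_implies; apply: measurable_pred.
by apply: measurable_fun_ltr; exact: measurable_tnth.
Qed.

(** The rank of a coordinate is the number of larger coordinates, which
does not refer to s. *)
Lemma order_simplex_inj n (s t : 'S_n) z :
  order_simplex s z -> order_simplex t z -> s = t.
Proof.
move=> [_ sz] [_ tz].
have E (u : 'S_n) : (forall i j, (u i < u j)%N -> tnth z j < tnth z i) ->
    forall i, (u i : nat) = #|[set j | tnth z i < tnth z j]%SET|.
  move=> uz i; rewrite -[LHS]card_perm_lt; congr #|pred_of_set _|.
  apply/setP => j; rewrite !inE; apply/idP/idP => [|ij]; first exact: uz.
  rewrite ltnNge leq_eqVlt; apply/negP => /orP[/eqP/val_inj/perm_inj ij'|/uz].
    by rewrite ij' ltxx in ij.
  by rewrite ltNge (ltW ij).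
by apply/permP => i; apply/val_inj; rewrite /= (E s)// (E t).
Qed.

Lemma order_simplex_cover n (z : n.-tuple R) :
  (forall i, 0 < tnth z i <= 1) -> injective (tnth z) ->
  exists s : 'S_n, order_simplex s z.
Proof.
move=> z01 zinj; pose A i := [set j | tnth z i < tnth z j]%SET.
have An i : (#|A i| < n)%N.
  have /proper_card : A i \proper [set: 'I_n]%SET.
    by apply/properP; split=> //; exists i; rewrite ?inE ?ltxx.
  by rewrite cardsT card_ord.
have Alt i j : tnth z j < tnth z i -> (#|A i| < #|A j|)%N.
  move=> ji; apply: proper_card; apply/properP; split.
    by apply/fintype.subsetP => k; rewrite !inE; exact: lt_trans.
  by exists i; rewrite !inE ?ltxx.
pose f i := Ordinal (An i).
have finj : injective f.
  move=> i j fij; have Aij : #|A i| = #|A j| := congr1 val fij.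
  by have [/Alt|/Alt|/zinj //] := ltgtP (tnth z i) (tnth z j);
    rewrite Aij ltnn.
exists (perm finj); split=> // i j; rewrite !permE /= => Aij.
have [/Alt|//|/zinj ij] := ltgtP (tnth z i) (tnth z j).
  by rewrite ltnNge (ltnW Aij).
by rewrite ij ltnn in Aij.
Qed.

Lemma lebesgue_order_simplex_perm n (s : 'S_n) :
  mu n (order_simplex s) = mu n (order_simplex 1).
Proof.
rewrite -(lebesgue_tuple_permute s (measurable_order_simplex s)).
congr (mu n _); apply/seteqP; split=> z [z01 zs]; split=> i.
- by have := z01 ((s^-1)%g i); rewrite tnth_mktuple permKV.
- move=> j; rewrite !perm1 => ij.
  have := zs ((s^-1)%g i) ((s^-1)%g j).
  by rewrite !permKV !tnth_mktuple !permKV; exact.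
- by rewrite tnth_mktuple.
- by move=> j sij; rewrite !tnth_mktuple; apply: zs; rewrite !perm1.
Qed.

Definition degenerate n : set (n.-tuple R) :=
  [set z | (exists i, tnth z i = 0) \/
           (exists ij : 'I_n * 'I_n,
              ij.1 != ij.2 /\ tnth z ij.1 = tnth z ij.2)].

Lemma negligible_degenerate n : (mu n).-negligible (@degenerate n).
Proof.
have null i (h : n.-tuple R -> R) : measurable_fun setT h ->
    (forall z x, h (subst_tuple z i x) = h z) ->
    (mu n).-negligible [set z | tnth z i = h z].
  move=> mh hi; have mih : measurable [set z | tnth z i = h z].
    rewrite (_ : mkset _ = [set z | tnth z i == h z]); last first.
      by apply/seteqP; split=> z /= /eqP.
    apply: measurable_pred; apply: measurable_fun_eqr => //.
    exact: measurable_tnth.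
  exists [set z | tnth z i = h z]; split=> //.
  apply: (lebesgue_tuple_null_slices (i := i)) => //.
  move=> z; rewrite (_ : mkset _ = [set h z]) ?lebesgue_measure_set1//.
  by apply/seteqP; split=> x /=; rewrite tnth_subst eqxx hi.
apply: negligibleU; apply: negligible_finType => i.
  by apply: (null i (fun=> 0)).
case: i => i j /=; have [->|ij] := eqVneq i j.
  by apply: negligibleS (negligible_set0 _) => z [].
apply: (negligibleS _ (null i (fun z => tnth z j) _ _)).
- by move=> z [].
- exact: measurable_tnth.
- by move=> z x; rewrite tnth_subst eq_sym (negbTE ij).
Qed.

Lemma lebesgue_union_simplices n (E : set (n.-tuple R)) (S : {set 'S_n}) :
  measurable E -> (forall z, E z -> forall i, 0 <= tnth z i <= 1) ->
  (forall s, s \in S -> order_simplex s `<=` E) ->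
  (forall s z, s \notin S -> order_simplex s z -> ~ E z) ->
  mu n E = (\sum_(s in S) mu n (order_simplex (1 : 'S_n)))%E.
Proof.
move=> mE E01 SE nSE.
pose U := [set z | exists2 s, s \in S & order_simplex s z].
have mU : measurable U.
  rewrite (_ : U = \bigcup_(s in [set` S]) order_simplex s) //.
  apply: fin_bigcup_measurable => // s _; exact: measurable_order_simplex.
rewrite (measure_diff_negligible mE mU (@negligible_degenerate n)).
  rewrite measure_finType_disjoint.
  - by apply: eq_bigr => s _; exact: lebesgue_order_simplex_perm.
  - by move=> s _; exact: measurable_order_simplex.
  - by move=> s t z _ _; exact: order_simplex_inj.
move=> z Nz; split=> [Ez|[s sS]]; last exact: SE.
have [||s sz] := @order_simplex_cover _ z.
- move=> i; have /andP[z0 ->] := E01 _ Ez i; rewrite andbT lt_neqAle z0 andbT.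
  by apply/eqP => z0'; apply: Nz; left; exists i.
- move=> i j zij; apply/eqP/negPn/negP => ij; apply: Nz; right.
  by exists (i, j).
by exists s => //; apply/negPn/negP => /nSE/(_ sz).
Qed.

(** The n! simplices are congruent under permutations of the coordinates and
fill the unit cube. *)
Lemma lebesgue_order_simplex n :
  mu n (order_simplex (1 : 'S_n)) = (n`!%:R^-1)%:E.
Proof.
have cube : (mu n (box (fun=> `[0%R, 1%R]%classic)) = 1)%E.
  rewrite [LHS]lebesgue_tuple_box// big1// => i _.
  by rewrite lebesgue_measure_itv/= lte_fin ltr01 -EFinD subr0.
have : mu n (box (fun=> `[0%R, 1%R]%classic)) =
    (\sum_(s in [set: 'S_n]%SET) mu n (order_simplex (1 : 'S_n)))%E.
  apply: lebesgue_union_simplices.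
  - exact: measurable_box.
  - by move=> z H i; have := H i; rewrite /= in_itv.
  - move=> s _ z [z01 _] i /=; rewrite in_itv /=.
    by have /andP[/ltW -> ->] := z01 i.
  - by move=> s z; rewrite inE.
rewrite cube; set v := mu n _.
have vfin : v \is a fin_num.
  rewrite ge0_fin_numE ?measure_ge0//.
  apply: (@le_lt_trans _ _ 1%E); last by rewrite ltry.
  rewrite -cube; apply: le_measure; rewrite ?inE.
  - exact: measurable_order_simplex.
  - exact: measurable_box.
  - move=> z [z01 _] i /=; rewrite in_itv /=.
    by have /andP[/ltW -> ->] := z01 i.
rewrite -(fineK vfin) sumEFin => -[]; rewrite sumr_const cardsT card_Sn => v1.
congr (_%:E); apply: (@mulIf _ n`!%:R).
  by rewrite pnatr_eq0 -lt0n fact_gt0.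
by rewrite mulVf ?pnatr_eq0 -?lt0n ?fact_gt0// mulr_natr -v1.
Qed.

(** A region of the unit cube that each ordering of the coordinates decides
has a volume obtained by counting orderings. This applies to E closed,
open or neither: only the interior of the simplices matters. *)
Lemma lebesgue_order_region n (E : set (n.-tuple R)) (S : {set 'S_n}) :
  measurable E -> (forall z, E z -> forall i, 0 <= tnth z i <= 1) ->
  (forall s, s \in S -> order_simplex s `<=` E) ->
  (forall s z, s \notin S -> order_simplex s z -> ~ E z) ->
  mu n E = (#|S|%:R / n`!%:R)%:E.
Proof.
move=> mE E01 SE nSE; rewrite (lebesgue_union_simplices mE E01 SE nSE).
by rewrite lebesgue_order_simplex sumEFin sumr_const -[_ *+ #|S|]mulr_natl.
Qed.

End OrderSimplices.

(** * Decomposition of the polytope by peak sets *)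

Section Pieces.
Context (R : realType) (d : nat) (dispP dispQ : Order.disp_t).
Context (P : finPOrderType dispP) (Q : finPOrderType dispQ).
Variables (p : 'I_d -> P) (q : 'I_d -> Q).
Implicit Types (x z : 'I_d -> R) (u : R) (W S : {set 'I_d}).

Lemma bigmax0_attained (I : finType) (B : pred I) (F : I -> R) :
  \big[Num.max/0]_(i | B i) F i = 0 \/
  exists2 i, B i & \big[Num.max/0]_(i | B i) F i = F i.
Proof.
elim/big_ind: _ => [|a b [->|[i Bi ->]] [->|[j Bj ->]]|i Bi].
- by left.
- by left; rewrite maxxx.
- by rewrite maxEle; case: ifP; [right; exists j | left].
- by rewrite maxEle; case: ifP; [left | right; exists i].
- by rewrite maxEle; case: ifP; [right; exists j | right; exists i].
- by right; exists i.
Qed.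

Definition label_chain S := forall i j, i \in S -> j \in S -> (q i >=< q j)%O.

(** The dilates of the order polytope, and below those of the chain polytope,
are described by inequalities so as to include the factor 0. *)
Definition order_scaled (s : R) (k : 'I_d -> R) :=
  (forall i, 0 <= k i <= s) /\
  (forall i j, (p i <= p j)%O -> k j <= k i).

Definition chain_scaled u (l : 'I_d -> R) :=
  (forall i, 0 <= l i) /\ (forall S, label_chain S -> \sum_(i in S) l i <= u).

(** The point (x, 1 - 2 u) lies in the polytope. *)
Definition in_omega x u := 0 <= u <= 1 /\
  exists k l, [/\ order_scaled (1 - u) k, chain_scaled u l &
    forall i, x i = k i - l i].

(** The indices where x is nonnegative and agrees with its least
order-reversing majorant. *)
Definition peaks x : {set 'I_d} :=
  [set i | (0 <= x i) && [forall j, (p i <= p j)%O ==> (x j <= x i)]]%SET.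

(** Up to boundary points, the order polytope of the ordinal sum of the
subposet of P on W, a point of coordinate u, and the subposet of Q on the
complement of W. Weak inequalities on W and strict ones off W make the
regions correspond exactly to the peak sets. *)
Definition in_region W z u := [/\ 0 <= u <= 1,
  forall i, i \in W -> u <= z i <= 1,
  forall i j, i \in W -> j \in W -> (p i <= p j)%O -> z j <= z i,
  forall i, i \notin W -> 0 < z i <= u &
  forall i j, i \notin W -> j \notin W -> (q i < q j)%O -> z j < z i].

(** When z - u agrees with x on the peak set W of x, this is the least
nonnegative order-reversing function above x. *)
Definition order_hull W z u i : R :=
  \big[Num.max/0]_(j | (j \in W) && (p i <= p j)%O) (z j - u).

(** The correction term of Stanley's transfer map between the chain polytope
and the order polytope of Q off W. *)
Definition max_above W z i : R :=
  \big[Num.max/0]_(j | (j \notin W) && (q i < q j)%O) z j.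

Lemma peaksP x i : reflect
  (0 <= x i /\ forall j, (p i <= p j)%O -> x j <= x i) (i \in peaks x).
Proof.
rewrite inE; apply: (iffP andP) => -[x0].
  by move=> /forallP xi; split=> // j ij; have /implyP := xi j; exact.
by move=> xi; split=> //; apply/forallP => j; apply/implyP; exact: xi.
Qed.

Lemma order_hull_ge0 W z u i : 0 <= order_hull W z u i.
Proof. exact: bigmax_ge_id. Qed.

Lemma max_above_ge0 W z i : 0 <= max_above W z i.
Proof. exact: bigmax_ge_id. Qed.

Lemma order_hull_anti W z u i j : (p i <= p j)%O ->
  order_hull W z u j <= order_hull W z u i.
Proof.
move=> ij; apply: sub_bigmax => k /andP[-> jk] /=; exact: le_trans jk.
Qed.

Lemma order_hull_ge W z u i j : j \in W -> (p i <= p j)%O ->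
  z j - u <= order_hull W z u i.
Proof. by move=> jW ij; apply: (bigmax_sup j); rewrite ?jW. Qed.

Lemma max_above_ge W z i j : j \notin W -> (q i < q j)%O ->
  z j <= max_above W z i.
Proof. by move=> jW ij; apply: (bigmax_sup j); rewrite ?jW. Qed.

(** The change of variables between x and z: on W it shifts by u; off W it
replaces x by the excess order_hull - x, and applies the transfer map to it. *)
Section ChangeOfVariables.
Variables (W : {set 'I_d}) (x z : 'I_d -> R) (u : R).
Hypothesis zW : forall i, i \in W -> z i = x i + u.
Hypothesis znW : forall i, i \notin W ->
  z i = max_above W z i + order_hull W z u i - x i.

Lemma order_hull_le x' i : (0 <= x' i) ->
  (forall j, j \in W -> (p i <= p j)%O -> x j <= x' i) ->
  order_hull W z u i <= x' i.
Proof.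
move=> x0 xj; apply/bigmax_leP; split=> // j /andP[jW ij].
by rewrite zW// addrK; exact: xj.
Qed.

(** If x i is positive, a maximiser of x above i is a peak. *)
Lemma le_order_hull i : peaks x = W -> x i <= order_hull W z u i.
Proof.
move=> xW; have [x0|x0] := leP (x i) 0.
  exact: le_trans (order_hull_ge0 _ _ _ _).
case: (@arg_maxP _ _ _ i (fun j => p i <= p j)%O x (lexx _)) => j ij xj.
have jW : j \in W.
  rewrite -xW; apply/peaksP; split.
    exact: le_trans (ltW x0) (xj _ (lexx _)).
  by move=> l jl; apply: xj; exact: le_trans jl.
apply: le_trans (xj _ (lexx _)) _.
by rewrite -[x j](addrK u) -zW//; exact: order_hull_ge.
Qed.

Lemma lt_order_hull i : peaks x = W -> i \notin W -> x i < order_hull W z u i.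
Proof.
move=> xW iW; rewrite ltNge; apply: contra iW => xi; rewrite -xW.
apply/peaksP; split=> [|j ij].
  exact: le_trans (order_hull_ge0 _ _ _ _) xi.
apply: le_trans (le_order_hull j xW) _; apply: le_trans xi.
exact: order_hull_anti.
Qed.

Definition upper i := [set j | (q i < q j)%O]%SET.

Lemma upper_proper i j : (q i < q j)%O -> upper j \proper upper i.
Proof.
move=> ij; apply/properP; split; last by exists j; rewrite !inE ?ltxx.
by apply/fintype.subsetP => k; rewrite !inE; exact: lt_trans.
Qed.

(** Unfolding the transfer map: follow from i the elements that attain the
maxima. *)
Lemma chain_below i : i \notin W -> exists S, [/\ label_chain S, i \in S,
  forall j, j \in S -> (q i <= q j)%O &
  z i <= \sum_(j in S) (order_hull W z u j - x j)].
Proof.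
have [n] := ubnP #|upper i|; elim: n i => // n IHn i + iW.
rewrite ltnS => in_; rewrite znW// -addrA.
have [|[j /andP[jW ij]]] := bigmax0_attained
  (fun j => (j \notin W) && (q i < q j)%O) z; rewrite -/(max_above W z i) => ->.
  exists [set i]%SET; split.
  - by move=> j k; rewrite !inE => /eqP -> /eqP ->; exact: comparablexx.
  - by rewrite inE.
  - by move=> j; rewrite inE => /eqP ->.
  - by rewrite big_set1 add0r.
have [|S [cS jS Sj zj]] := IHn j _ jW.
  exact: leq_trans (proper_card (upper_proper ij)) in_.
have iS k : k \in S -> (q i < q k)%O by move=> /Sj; exact: lt_le_trans.
have niS : i \notin S by apply/negP => /iS; rewrite ltxx.
exists (i |: S)%SET; split.
- move=> k l; rewrite !inE => /predU1P[->|kS] /predU1P[->|lS].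
  + exact: comparablexx.
  + by apply: le_comparable; exact: ltW (iS _ lS).
  + by apply: ge_comparable; exact: ltW (iS _ kS).
  + exact: cS.
- by rewrite !inE eqxx.
- by move=> k; rewrite !inE => /predU1P[->//|/iS/ltW].
- by rewrite big_setU1//= addrC lerD2l.
Qed.

(** The chain polytope is closed under decreasing coordinates, so a
decomposition x = k - l can be improved to one in which k is the least
possible, namely the order hull. *)
Lemma in_region_of_in_omega : in_omega x u -> peaks x = W -> in_region W z u.
Proof.
move=> [u01 [k [l [[k0 kanti] [l0 lS] xE]]]] xW.
have hk i : order_hull W z u i <= k i.
  apply: order_hull_le => [|j jW ij]; first by have /andP[] := k0 i.
  rewrite xE; apply: le_trans (kanti _ _ ij).
  by rewrite lerBlDr lerDl.
split=> //.
- move=> i iW; have := iW; rewrite -xW zW// => /peaksP[x0 _].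
  rewrite lerDr x0 /=; have /andP[_ ki] := k0 i.
  by have := l0 i; move: ki (xE i); lra.
- move=> i j iW jW ij; rewrite !zW// lerD2r.
  by move: iW; rewrite -xW => /peaksP[_]; exact.
- move=> i iW; have xi := lt_order_hull xW iW; apply/andP; split.
    have := max_above_ge0 W z i; move: xi; rewrite [z i]znW//; lra.
  have [S [cS _ _ /le_trans]] := chain_below iW; apply.
  apply: le_trans (lS S cS); apply: ler_sum => j _.
  by rewrite xE opprB addrCA gerDl subr_le0.
- move=> i j iW jW ij; have xi := lt_order_hull xW iW.
  by have := max_above_ge z jW ij; rewrite [z i]znW//; lra.
Qed.

(** The least element of a chain is the one with the most elements above it. *)
Lemma chain_min S i0 : label_chain S -> i0 \in S ->
  exists2 i, i \in S & forall j, j \in S -> (q i <= q j)%O.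
Proof.
move=> cS i0S; have [i iS im] := arg_maxnP (fun j => #|upper j|) i0S.
exists i => // j jS; case: (comparable_leP (cS _ _ iS jS)) => // ji.
have := leq_trans (proper_card (upper_proper ji)) (im _ jS).
by rewrite ltnn.
Qed.

Section OfRegion.
Hypothesis q_inj : injective q.
Hypothesis reg : in_region W z u.

Lemma order_hull_peak i : i \in W -> order_hull W z u i = x i.
Proof.
have [_ zu zanti _ _] := reg => iW; apply/le_anti/andP; split.
  apply: order_hull_le => [|j jW ij].
    by have := zu i iW; rewrite zW//; lra.
  by have := zanti i j iW jW ij; rewrite !zW// lerD2r.
by rewrite -[leLHS](addrK u) -zW//; exact: order_hull_ge.
Qed.

Lemma order_hull_gt i : i \notin W -> x i < order_hull W z u i.
Proof.
have [_ _ _ z0 zlt] := reg => iW.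
suff : max_above W z i < z i by rewrite [ltRHS]znW//; lra.
apply/bigmax_ltP; split; first by have /andP[] := z0 i iW.
by move=> j /andP[jW ij]; exact: zlt.
Qed.

Lemma order_hull_ler i : x i <= order_hull W z u i.
Proof.
have [iW|iW] := boolP (i \in W); first by rewrite order_hull_peak.
exact: ltW (order_hull_gt iW).
Qed.

(** Removing the least element i of the chain, the rest sums to at most z j
for its own least element j, and z j is one of the values that max_above
majorizes at i. *)
Lemma sum_chain_le S i : label_chain S ->
  (forall j, j \in S -> j \notin W) -> i \in S ->
  (forall j, j \in S -> (q i <= q j)%O) ->
  \sum_(j in S) (order_hull W z u j - x j) <= z i.
Proof.
have [n] := ubnP #|S|; elim: n S i => // n IHn S i.
rewrite ltnS => Sn cS nW iS Si.
rewrite (big_setD1 i)//= [z i]znW ?nW//.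
suff : \sum_(j in (S :\ i)%SET) (order_hull W z u j - x j) <=
  max_above W z i by lra.
have [->|[j0 j0S]] := set_0Vmem (S :\ i)%SET.
  by rewrite big_set0 max_above_ge0.
have cS' : label_chain (S :\ i)%SET.
  by move=> j k /setD1P[_ jS] /setD1P[_ kS]; exact: cS.
have [j jS' jm] := chain_min cS' j0S.
have /setD1P[ji jS] := jS'.
apply: (@le_trans _ _ (z j)).
  apply: IHn => //.
    by apply: leq_trans Sn; rewrite [leqRHS](cardsD1 i) iS.
  by move=> k /setD1P[_]; exact: nW.
apply: max_above_ge; first exact: nW.
by rewrite lt_neqAle Si// andbT (inj_eq q_inj) eq_sym.
Qed.

Lemma in_omega_of_in_region : in_omega x u.
Proof.
have [u01 zu zanti z0 zlt] := reg; split=> //.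
exists (order_hull W z u), (fun i => order_hull W z u i - x i); split.
- split=> [i|i j]; last exact: order_hull_anti.
  rewrite order_hull_ge0; apply/bigmax_leP; split; first by lra.
  by move=> j /andP[jW _]; have := zu j jW; lra.
- split=> [i|S cS]; first by rewrite subr_ge0 order_hull_ler.
  rewrite (bigID (mem W)) /= big1 ?add0r; last first.
    by move=> i /andP[_ iW]; rewrite order_hull_peak// subrr.
  rewrite (eq_bigl (mem (S :\: W)%SET)); last by move=> i; rewrite !inE andbC.
  have [->|[i0 i0S]] := set_0Vmem (S :\: W)%SET.
    by rewrite big_set0; case/andP: u01.
  have cSW : label_chain (S :\: W)%SET.
    by move=> i j /setDP[iS _] /setDP[jS _]; exact: cS.
  have [i iS im] := chain_min cSW i0S.
  have /setDP[_ iW] := iS.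
  apply: le_trans (sum_chain_le cSW _ iS im) _; last by have /andP[] := z0 i iW.
  by move=> j /setDP[].
- by move=> i; rewrite opprB addrC subrK.
Qed.

Lemma peaks_of_in_region : peaks x = W.
Proof.
have [u01 zu zanti z0 zlt] := reg; apply/setP => i; apply/peaksP/idP.
  move=> [x0 xi]; apply: contraT => iW; have := order_hull_gt iW.
  have [|[j /andP[jW ij]]] := bigmax0_attained
    (fun j => (j \in W) && (p i <= p j)%O) (fun j => z j - u).
    by rewrite -/(order_hull W z u i) => ->; rewrite ltNge x0.
  by rewrite -/(order_hull W z u i) => ->; rewrite zW// addrK ltNge xi.
move=> iW; rewrite -(order_hull_peak iW).
split=> [|j ij]; first exact: order_hull_ge0.
by apply: le_trans (order_hull_ler j) _; exact: order_hull_anti.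
Qed.

End OfRegion.
End ChangeOfVariables.
End Pieces.

(** * Inequalities for the polytope *)

Section OmegaInequalities.
Context (R : realType) (d : nat) (dispP dispQ : Order.disp_t).
Context (P : finPOrderType dispP) (Q : finPOrderType dispQ).
Variables (p : 'I_d -> P) (q : 'I_d -> Q).

Lemma order_polytopeE (x : 'rV[R]_d) :
  order_polytope R p x <-> order_scaled p 1 (x 0).
Proof. by []. Qed.

(** Bounding the sums over maximal chains bounds them over all chains, since
the coordinates are nonnegative. *)
Lemma chain_polytopeE (x : 'rV[R]_d) :
  chain_polytope R q x <-> chain_scaled q 1 (x 0).
Proof.
split=> -[x0 xS].
  split=> // S cS.
  have : is_chain (q @: S).
    apply/forall_inP => _ /imsetP[i iS ->].
    apply/forall_inP => _ /imsetP[j jS ->].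
    exact: cS.
  move=> /maxset_exists[C maxC SC]; apply: le_trans (xS C maxC).
  rewrite [leRHS](bigID (mem S)) /= [leRHS]addrC.
  rewrite [X in _ <= _ + X](eq_bigl (mem S)) ?lerDr ?sumr_ge0//.
  move=> i /=; rewrite andb_idl// => iS; apply: (fintype.subsetP SC).
  exact: imset_f.
split=> // C /maxsetp cC.
have := xS [set i | q i \in C]%SET.
rewrite (eq_bigl (fun i => q i \in C)) => [|i]; last by rewrite inE.
apply=> i j; rewrite !inE => iC jC.
by move/forall_inP : cC => /(_ _ iC)/forall_inP/(_ _ jC).
Qed.

Definition base (w : 'rV[R]_(d + 1)) (i : 'I_d) : R := w 0 (lshift 1 i).

(** The last coordinate, equal to 1 on the copy of the order polytope and to
-1 on the copy of the chain polytope. *)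
Definition height (w : 'rV[R]_(d + 1)) : R := w 0 (rshift d ord0).

Lemma base_row_mx (x : 'rV[R]_d) (y : 'rV[R]_1) i : base (row_mx x y) i = x 0 i.
Proof. exact: row_mxEl. Qed.

Lemma height_row_mx (x : 'rV[R]_d) (y : 'rV[R]_1) : height (row_mx x y) = y 0 0.
Proof. exact: row_mxEr. Qed.

Lemma row_base_height (w w' : 'rV[R]_(d + 1)) :
  base w =1 base w' -> height w = height w' -> w = w'.
Proof.
move=> bw hw; apply/rowP => i; case: (splitP i) => j ij.
  rewrite (_ : i = lshift 1 j); [exact: bw | exact: val_inj].
by rewrite (_ : i = rshift d ord0)//; apply: val_inj; rewrite /= ij (ord1 j).
Qed.

Lemma base_conv t (v w : convex_lmodType 'rV[R]_(d + 1)) i :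
  base (conv t v w) i = t%:num * base v i + (1 - t%:num) * base w i.
Proof. by rewrite /base !mxE. Qed.

Lemma height_conv t (v w : convex_lmodType 'rV[R]_(d + 1)) :
  height (conv t v w) = t%:num * height v + (1 - t%:num) * height w.
Proof. by rewrite /height !mxE. Qed.

Lemma in_omega_convex x y u v (t : R) : 0 <= t <= 1 ->
  in_omega p q x u -> in_omega p q y v ->
  in_omega p q (fun i => t * x i + (1 - t) * y i) (t * u + (1 - t) * v).
Proof.
move=> t01 [u01 [k [l [[k0 ka] [l0 lS] xE]]]].
move=> [v01 [k' [l' [[k'0 k'a] [l'0 l'S] yE]]]].
have /andP[t0 t1] := t01; have t1' : 0 <= 1 - t by rewrite subr_ge0.
split; first by nra.
exists (fun i => t * k i + (1 - t) * k' i), (fun i => t * l i + (1 - t) * l' i).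
split; [split=> [i|i j ij]|split=> [i|S cS]|].
- by have := k0 i; have := k'0 i; nra.
- by rewrite lerD// ler_wpM2l//; [exact: ka | exact: k'a].
- by rewrite addr_ge0// mulr_ge0.
- rewrite big_split /= -!mulr_sumr lerD// ler_wpM2l//; [exact: lS | exact: l'S].
- by move=> i; rewrite xE yE; ring.
Qed.

Lemma chain_scaled0 l : chain_scaled q (0 : R) l -> forall i, l i = 0.
Proof.
move=> [l0 lS] i; apply/le_anti; rewrite l0 andbT.
have := lS [set i]%SET; rewrite big_set1; apply=> a b.
by rewrite !inE => /eqP -> /eqP ->; exact: comparablexx.
Qed.

Lemma order_scaled0 k : order_scaled p (0 : R) k -> forall i, k i = 0.
Proof. by move=> [k0 _] i; apply/le_anti; rewrite andbC. Qed.

(** The right-hand side is convex in w and holds on both generating polytopes.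
Conversely x = k - l is the convex combination with weights 1 - u and u
of k / (1 - u) and - l / u, the two extreme heights being treated apart. *)
Lemma OmegaE (w : 'rV[R]_(d + 1)) :
  Omega (order_polytope R p) (chain_polytope R q) w <->
  in_omega p q (base w) ((1 - height w) / 2).
Proof.
split.
  move=> /(_ [set v | in_omega p q (base v) ((1 - height v) / 2)]); apply.
  split=> [x y t|].
    move=> /set_mem ox /set_mem oy; apply/mem_set => /=.
    have := @in_omega_convex _ _ _ _ t%:num _ ox oy.
    rewrite (_ : (fun i => _) = base (conv t x y)); last first.
      by apply/funext => i; rewrite base_conv.
    rewrite (_ : t%:num * _ + _ = (1 - height (conv t x y)) / 2).
      by apply; rewrite ge0 le1.
    by rewrite height_conv; field.
  move=> _ [[x /order_polytopeE[x0 xa] <-]|[y /chain_polytopeE[y0 yS] <-]].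
    rewrite /= height_row_mx mxE subrr mul0r.
    split; first by rewrite lexx ler01.
    exists (x 0), (fun=> 0); rewrite subr0; split.
    - by split.
    - by split=> // S _; rewrite big1.
    - by move=> i; rewrite base_row_mx subr0.
  rewrite /= height_row_mx mxE opprK (_ : (1 + 1) / 2 = 1); last by field.
  split; first by rewrite lexx ler01.
  exists (fun=> 0), (y 0); rewrite subrr; split.
  - by split=> // i; rewrite lexx.
  - by split.
  - by move=> i; rewrite base_row_mx mxE sub0r.
move=> [u01 [k [l [ok cl wE]]]] M [cM MW]; set u := _ / 2 in u01 ok cl.
have hw : height w = 1 - 2 * u by rewrite /u; field.
have [u0|u0] := eqVneq u 0.
  apply: MW; left; exists (\row_i k i).
    apply/order_polytopeE; rewrite u0 subr0 in ok.
    by rewrite (_ : _ 0 = k)//; apply/funext => i; rewrite mxE.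
  rewrite u0 in cl; apply: row_base_height => [i|].
    by rewrite base_row_mx mxE wE (chain_scaled0 cl) subr0.
  by rewrite height_row_mx mxE hw u0 mulr0 subr0.
have [u1|u1] := eqVneq u 1.
  apply: MW; right; exists (\row_i l i).
    apply/chain_polytopeE; rewrite u1 in cl.
    by rewrite (_ : _ 0 = l)//; apply/funext => i; rewrite mxE.
  rewrite u1 subrr in ok; apply: row_base_height => [i|].
    by rewrite base_row_mx !mxE wE (order_scaled0 ok) sub0r.
  by rewrite height_row_mx mxE hw u1; ring.
have {}u0 : 0 < u by have /andP[] := u01; rewrite le_eqVlt eq_sym (negbTE u0).
have {}u1 : 0 < 1 - u.
  by have /andP[_] := u01; rewrite le_eqVlt (negbTE u1) subr_gt0.
have u1' : 1 - u <= 1 by rewrite gerBl ltW.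
pose X : 'rV[R]_d := \row_i (k i / (1 - u)).
pose Y : 'rV[R]_d := \row_i (l i / u).
have XM : M (row_mx X (const_mx 1)).
  apply: MW; left; exists X => //; apply/order_polytopeE.
  have [k0 ka] := ok; split=> [i|i j ij]; rewrite !mxE.
    have /andP[ki ki1] := k0 i.
    by rewrite divr_ge0 ?(ltW u1)//= ler_pdivrMr// mul1r.
  by rewrite ler_pM2r ?invr_gt0//; exact: ka.
have YM : M (row_mx (- Y) (const_mx (-1))).
  apply: MW; right; exists Y => //; apply/chain_polytopeE.
  have [l0 lS] := cl; split=> [i|S cS]; first by rewrite mxE divr_ge0// ltW.
  under eq_bigr do rewrite mxE.
  by rewrite -mulr_suml ler_pdivrMr// mul1r; exact: lS.
have := cM _ _ (Itv01 (ltW u1) u1') (mem_set XM) (mem_set YM).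
rewrite inE; congr (M _); apply: row_base_height => [i|].
  rewrite base_conv !base_row_mx !mxE wE /=; field.
  by rewrite !gt_eqF.
by rewrite height_conv !height_row_mx !mxE hw /=; ring.
Qed.

End OmegaInequalities.

(** * Volumes of the pieces *)

Section PieceVolume.
Context (R : realType) (d : nat) (dispP dispQ : Order.disp_t).
Context (P : finPOrderType dispP) (Q : finPOrderType dispQ).
Variables (p : 'I_d -> P) (q : 'I_d -> Q).
Hypotheses (p_inj : injective p) (q_inj : injective q).
Local Notation mu := (lebesgue_tuple R).

Definition low (z : (d + 1).-tuple R) (i : 'I_d) : R := tnth z (lshift 1 i).
Definition top (z : (d + 1).-tuple R) : R := tnth z (rshift d ord0).

Lemma ord_addn1_ind (B : 'I_(d + 1) -> Prop) :
  (forall i, B (lshift 1 i)) -> B (rshift d ord0) -> forall i, B i.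
Proof.
move=> Bl Br i; rewrite -[i]fintype.splitK.
case: (fintype.split i) => j /=; first exact: Bl.
by rewrite (ord1 j).
Qed.

Lemma split_lshift (i : 'I_d) : fintype.split (lshift 1 i) = inl i.
Proof. by rewrite -(fintype.unsplitK (inl i)). Qed.

Lemma split_rshift (i : 'I_1) : fintype.split (rshift d i) = inr i.
Proof. by rewrite -(fintype.unsplitK (inr i)). Qed.

Lemma measurable_low i : measurable_fun setT (fun z => low z i).
Proof. exact: measurable_tnth. Qed.

Lemma measurable_top : measurable_fun setT top.
Proof. exact: measurable_tnth. Qed.

Definition piece (W : {set 'I_d}) : set ((d + 1).-tuple R) :=
  [set t | in_omega p q (low t) ((1 - top t) / 2) /\ peaks p (low t) = W].

Definition region (W : {set 'I_d}) : set ((d + 1).-tuple R) :=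
  [set z | in_region p q W (low z) (top z)].

Lemma measurable_region W : measurable (region W).
Proof.
have mle f g : measurable_fun setT f -> measurable_fun setT g ->
    measurable [set z : (d + 1).-tuple R | f z <= g z :> R].
  by move=> mf mg; apply: measurable_pred; exact: measurable_fun_ler.
have mlt f g : measurable_fun setT f -> measurable_fun setT g ->
    measurable [set z : (d + 1).-tuple R | f z < g z :> R].
  by move=> mf mg; apply: measurable_pred; exact: measurable_fun_ltr.
have ml := measurable_low; have mt := measurable_top.
rewrite (_ : region W =
  ([set z | 0 <= top z] `&` [set z | top z <= 1]) `&`
  [set z | forall i, i \in W ->
     ([set z | top z <= low z i] `&` [set z | low z i <= 1]) z] `&`
  [set z | forall i j, i \in W -> j \in W -> (p i <= p j)%O ->
     low z j <= low z i] `&`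
  [set z | forall i, i \notin W ->
     ([set z | 0 < low z i] `&` [set z | low z i <= top z]) z] `&`
  [set z | forall i j, i \notin W -> j \notin W -> (q i < q j)%O ->
     low z j < low z i]).
  repeat apply: measurableI; try by [apply: mle | apply: mlt].
  - apply: measurable_forall => i; apply: measurable_implies.
    by apply: measurableI; apply: mle.
  - apply: measurable_forall => i; apply: measurable_forall => j.
    by do 3! apply: measurable_implies; exact: mle.
  - apply: measurable_forall => i; apply: measurable_implies.
    by apply: measurableI; [apply: mlt | apply: mle].
  - apply: measurable_forall => i; apply: measurable_forall => j.
    by do 3! apply: measurable_implies; exact: mlt.
apply/seteqP; split=> z.
  move=> [/andP[u0 u1] h1 h2 h3 h4]; split=> //; split=> //.
    by split=> //; split=> // i /h1/andP[].
  by move=> i /h3/andP[].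
move=> [[[[[/= u0 u1] h1] h2] h3] h4]; split=> //; first by rewrite u0.
  by move=> i /h1[/= -> ->].
by move=> i /h3[/= -> ->].
Qed.

(** The map from (x, t) to (z, u) is triangular for the order in which u comes
first, then the coordinates in W, then those off W from the top of Q
downwards. Its diagonal entries are 1 and -1, except for the entry -1/2 of
u = (1 - t) / 2, which accounts for the factor 2. *)
Lemma lebesgue_piece W :
  measurable (piece W) /\
  mu (d + 1) (piece W) = (2%:E * mu (d + 1) (region W))%E.
Proof.
pose rk (i : 'I_(d + 1)) : nat := match fintype.split i with
  | inl j => if j \in W then 1 else #|upper q j|.+2
  | inr _ => 0 end.
pose c (i : 'I_(d + 1)) : R := match fintype.split i with
  | inl j => if j \in W then 1 else -1 | inr _ => - 2^-1 end.
pose f (i : 'I_(d + 1)) (z : (d + 1).-tuple R) : R := match fintype.split i with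
  | inl j => if j \in W then top z
             else max_above q W (low z) j + order_hull p W (low z) (top z) j
  | inr _ => 2^-1 end.
have [] := @lebesgue_tuple_triangular R _ rk c f.
- move=> i; rewrite /c; case: fintype.split => [j|_].
  2: by rewrite oppr_eq0 invr_eq0.
  by case: ifP => _; rewrite ?oppr_eq0 oner_eq0.
- move=> i; rewrite /f; case: fintype.split => [j|_].
  2: exact: measurable_cst.
  case: (j \in W); first exact: measurable_top.
  apply: measurable_funD; apply: measurable_bigmax0 => k.
    exact: measurable_low.
  by apply: measurable_funB; [exact: measurable_low | exact: measurable_top].
- apply: ord_addn1_ind => [i|] z z' zz';
    rewrite /f ?split_rshift // split_lshift.
  have tE : top z = top z'.
    by apply: zz'; rewrite /rk split_rshift split_lshift; case: ifP.
  case: ifP => // iW; rewrite tE; congr (_ + _).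
    apply: eq_bigr => j /andP[jW ij]; apply: zz'.
    rewrite /rk !split_lshift iW (negbTE jW) !ltnS.
    exact: proper_card (upper_proper ij).
  apply: eq_bigr => j /andP[jW ij]; congr (_ - _); apply: zz'.
  by rewrite /rk !split_lshift iW jW.
move=> G [mG GE muG].
have pieceE : piece W = G @^-1` region W.
  have topG t : top (G t) = (1 - top t) / 2.
    by rewrite {1}/top GE /c /f split_rshift /top; field.
  have lowGW t (i : 'I_d) : i \in W -> low (G t) i = low t i + top (G t).
    by move=> iW; rewrite {1}/low GE /c /f split_lshift iW mul1r.
  have lowGnW t (i : 'I_d) : i \notin W -> low (G t) i =
      max_above q W (low (G t)) i + order_hull p W (low (G t)) (top (G t)) i
      - low t i.
    move=> /negbTE iW; rewrite {1}/low GE /c /f split_lshift iW.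
    by rewrite mulN1r addrC.
  apply/seteqP; split=> t.
    move=> [ot tW]; rewrite -topG in ot.
    exact: in_region_of_in_omega (lowGW t) (lowGnW t) ot tW.
  move=> rt; split.
    rewrite -topG; exact: in_omega_of_in_region (lowGW t) (lowGnW t) q_inj rt.
  exact: peaks_of_in_region (lowGW t) (lowGnW t) rt.
have mR := measurable_region W.
split; first by rewrite pieceE; exact: measurable_preimageT mG mR.
rewrite pieceE muG//; congr (_%:E * _)%E.
rewrite big_split_ord /= big_ord1 /c split_rshift big1 => [|i _].
  by rewrite mul1r normrN ger0_norm ?invrK// invr_ge0.
by rewrite split_lshift; case: ifP => _; rewrite ?normrN normr1 invr1.
Qed.

(** The hypotheses on r say that it is the strict order of the ordinal sum in
which rshift d ord0 stands between W and its complement. *)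
Lemma lebesgue_region (W : {set 'I_d}) (r : rel 'I_(d + 1)) :
  (forall i j, r (lshift 1 i) (lshift 1 j) =
     if i \in W then (j \in W) ==> (p i < p j)%O
     else (j \notin W) && (q i < q j)%O) ->
  (forall i, r (lshift 1 i) (rshift d ord0) = (i \in W)) ->
  (forall j, r (rshift d ord0) (lshift 1 j) = (j \notin W)) ->
  r (rshift d ord0) (rshift d ord0) = false ->
  mu (d + 1) (region W) =
    (#|extensions r|%:R / (d + 1)`!%:R)%:E.
Proof.
move=> rLL rLR rRL rRR; apply: lebesgue_order_region.
- exact: measurable_region.
- move=> z [u01 zu _ z0 _]; apply: ord_addn1_ind => // i.
  have [iW|iW] := boolP (i \in W).
    by have := zu i iW; rewrite /low; lra.
  by have := z0 i iW; rewrite /low; lra.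
- move=> s /extensionsP rs z [z01 zs].
  have rz i j : r i j -> tnth z j < tnth z i by move=> /rs; exact: zs.
  split.
  + by have := z01 (rshift d ord0); rewrite /top; lra.
  + move=> i iW; apply/andP; split; last by have /andP[] := z01 (lshift 1 i).
    by apply/ltW/rz; rewrite rLR.
  + move=> i j iW jW; rewrite le_eqVlt => /predU1P[/p_inj -> //|ij].
    by apply/ltW/rz; rewrite rLL iW jW.
  + move=> i iW; apply/andP; split; first by have /andP[] := z01 (lshift 1 i).
    by apply/ltW/rz; rewrite rRL.
  + by move=> i j iW jW ij; apply: rz; rewrite rLL (negbTE iW) jW.
- move=> s z /negP + [z01 zs] [u01 zu zanti z0 zlt]; apply.
  have rz i j : r i j -> tnth z j <= tnth z i.
    move: i j; apply: ord_addn1_ind => [i|]; apply: ord_addn1_ind => [j|].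
    + rewrite rLL; have [iW|iW] := boolP (i \in W);
        have [jW|jW] := boolP (j \in W) => //=.
      * by move=> /ltW; exact: zanti.
      * move=> _; have /andP[+ _] := zu i iW; apply: le_trans.
        by have /andP[] := z0 j jW.
      * by move=> /(zlt _ _ iW jW)/ltW.
    + by rewrite rLR => iW; have /andP[] := zu i iW.
    + by rewrite rRL => jW; have /andP[] := z0 j jW.
    + by rewrite rRR.
  apply/extensionsP => i j rij; rewrite ltnNge leq_eqVlt.
  apply/negP => /predU1P[/val_inj/perm_inj ji|/zs].
    move: rij; rewrite ji; move: i {ji}.
    apply: ord_addn1_ind; last by rewrite rRR.
    by move=> i; rewrite rLL !ltxx andbF; case: (i \in W).
  by rewrite ltNge rz.
Qed.

End PieceVolume.

(** * Counting linear extensions of Delta_W *)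

Section CountingExtensions.

Lemma num_linear_extensionsE n (disp : Order.disp_t) (D : finPOrderType disp)
    (l : 'I_n -> D) : bijective l ->
  num_linear_extensions D = #|extensions (fun i j => (l i < l j)%O)|.
Proof.
move=> bl; have nD : n = #|D| by rewrite -(bij_eq_card bl) card_ord.
move: l bl; rewrite nD => l bl {n nD}.
have finj : injective (enum_rank \o l).
  by apply: inj_comp (bij_inj bl); exact: enum_rank_inj.
pose f (s : 'S_#|D|) := (perm finj * s^-1)%g.
have f_inj : injective f by move=> s t /mulgI/invg_inj.
rewrite -(card_preimset _ f_inj) /num_linear_extensions; congr #|pred_of_set _|.
apply/setP => s; rewrite inE [RHS]inE.
apply/idP/extensionsP => [/forallP sl i j lij|sl].
  have /forallP/(_ (f s j))/implyP := sl (f s i); apply.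
  by rewrite /f !permM !permKV ![perm finj _]permE /= !enum_rankK.
have l_of y : exists i, l i = y by have [g _ gK] := bl; exists (g y).
apply/forallP => a; apply/forallP => b; apply/implyP.
have [i li] := l_of (enum_val (s a)); have [j lj] := l_of (enum_val (s b)).
rewrite -li -lj => /sl; rewrite /f !permM ![perm finj _]permE /= li lj.
by rewrite !enum_valK !permK.
Qed.

Section DeltaLabels.
Context (n : nat) (dispP dispQ : Order.disp_t).
Context (P : finPOrderType dispP) (Q : finPOrderType dispQ).
Variables (p : 'I_n -> P) (q : 'I_n -> Q) (V : {set 'I_n}).
Hypotheses (p_bij : bijective p) (q_bij : bijective q).

(** The strict order of Delta_W transported to the labels. *)
Definition Delta_rel : rel 'I_n := fun i j =>
  if i \in V then (j \in V) ==> (p i < p j)%O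
  else (j \notin V) && (q i < q j)%O.

Lemma Delta_card : #|Delta p q V| = n.
Proof.
have card_sub (T : finType) (A : {set T}) : #|{: {x : T | x \in A}}| = #|A|.
  by rewrite card_sig; apply: eq_card => x.
transitivity (#|[set p i | i in V]%SET| + #|[set q i | i in ~: V]%SET|)%N.
  by rewrite -!card_sub -card_sum.
by rewrite !card_imset ?cardsC ?card_ord//; exact: bij_inj.
Qed.

Definition Delta_label (i : 'I_n) : Delta p q V :=
  match boolP (i \in V) with
  | AltTrue iV => inl (exist _ (p i) (imset_f p iV))
  | AltFalse iV =>
    inr (exist _ (q i) (imset_f q (etrans (finset.in_setC i V) iV)))
  end.

Lemma Delta_label_bij : bijective Delta_label.
Proof.
apply: inj_card_bij; last by rewrite Delta_card card_ord.
move=> i j; rewrite /Delta_label.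
case: {-}_ / boolP => iV; case: {-}_ / boolP => jV //.
  by move=> [/(bij_inj p_bij)].
by move=> [/(bij_inj q_bij)].
Qed.

Lemma Delta_label_lt i j : (Delta_label i < Delta_label j)%O = Delta_rel i j.
Proof.
rewrite lt_neqAle (inj_eq (bij_inj Delta_label_bij)) /Delta_rel /Delta_label.
case: {-}_ / boolP => iV; case: {-}_ / boolP => jV /=.
- transitivity ((i != j) && (p i <= p j)%O); first by [].
  by rewrite iV jV lt_neqAle (inj_eq (bij_inj p_bij)).
- transitivity ((i != j) && true); first by [].
  by rewrite iV (negbTE jV) andbT; apply: contraNneq jV => <-.
- transitivity ((i != j) && false); first by [].
  by rewrite (negbTE iV) jV andbF.
- transitivity ((i != j) && (q i <= q j)%O); first by [].
  by rewrite (negbTE iV) jV lt_neqAle (inj_eq (bij_inj q_bij)).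
Qed.

Lemma num_linear_extensions_Delta :
  num_linear_extensions (Delta p q V) = #|extensions Delta_rel|.
Proof.
rewrite (num_linear_extensionsE Delta_label_bij); congr #|pred_of_set _|.
by apply/setP => s; apply/extensionsP/extensionsP => sr i j;
  have := sr i j; rewrite Delta_label_lt.
Qed.

End DeltaLabels.

Section MoveLeast.
Context (n : nat) (dispP dispQ : Order.disp_t).
Context (P : finPOrderType dispP) (Q : finPOrderType dispQ).
Variables (p : 'I_n.+1 -> P) (q : 'I_n.+1 -> Q) (V : {set 'I_n.+1}).
Variable m : 'I_n.+1.
Hypotheses (mV : m \notin V) (p_least : forall i, i != m -> (p m < p i)%O)
  (q_least : forall i, i != m -> (q m < q i)%O).

Let card_V : (#|V| < n.+1)%N.
Proof.
by have := max_card (m |: V)%SET; rewrite card_ord cardsU1 mV.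
Qed.

Let k : 'I_n.+1 := Ordinal card_V.

(** The cycle that sends position #|V| to the front and shifts the positions
before it by one. *)
Definition move_to_front : 'S_n.+1 := lift_perm k ord0 1.

Lemma move_to_front_at : move_to_front k = ord0.
Proof. exact: lift_perm_id. Qed.

Lemma move_to_front_lt (a b : 'I_n.+1) : a != k -> b != k ->
  (move_to_front a < move_to_front b)%N = (a < b)%N.
Proof.
case: (unliftP k a) => [a' ->|->]; last by rewrite eqxx.
case: (unliftP k b) => [b' ->|->]; last by rewrite eqxx.
by rewrite /move_to_front !lift_perm_lift !perm1 /= !ltnNge !leq_bump2 !negbK.
Qed.

Lemma move_to_front_gt0 (a : 'I_n.+1) : (0 < move_to_front a)%N = (a != k).
Proof.
rewrite lt0n -(inj_eq (@perm_inj _ move_to_front)) move_to_front_at.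
by rewrite -(inj_eq val_inj).
Qed.

(** When m is not in V, it is the least element of the second summand, hence
forced into position #|V| of every linear extension; when it is added to V,
it is the least element of the whole and forced into the first position.
Moving it from one place to the other does not affect the rest of the
word. *)
Lemma card_extensions_move :
  #|extensions (Delta_rel p q V)| = #|extensions (Delta_rel p q (m |: V)%SET)|.
Proof.
have f_inj : injective (fun s : 'S_n.+1 => (s * move_to_front)%g).
  exact: mulIg.
rewrite -[RHS](card_preimset _ f_inj); congr #|pred_of_set _|; apply/setP => s.
rewrite [RHS]finset.in_set.
have r12 i j : i != m -> j != m ->
    Delta_rel p q (m |: V)%SET i j = Delta_rel p q V i j.
  by move=> im jm; rewrite /Delta_rel !inE (negbTE im) (negbTE jm).
have sk i : i != m -> s m = k -> s i != k.
  by move=> im <-; rewrite (inj_eq perm_inj).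
apply/extensionsP/extensionsP => rs.
  (* exactly the elements of V precede m *)
  have smk : s m = k.
    apply: val_inj; rewrite /= -(card_perm_lt s m); congr #|pred_of_set _|.
    apply/setP => i; rewrite inE; have [->|im] := eqVneq i m.
      by rewrite ltnn (negbTE mV).
    have [iV|iV] := boolP (i \in V).
      by rewrite rs// /Delta_rel iV (negbTE mV).
    apply/negbTE; rewrite -leqNgt ltnW// rs// /Delta_rel (negbTE mV) iV.
    exact: q_least.
  move=> i j; rewrite !permM; have [->|im] := eqVneq i m.
    rewrite smk move_to_front_at; have [->|jm _] := eqVneq j m.
      by rewrite /Delta_rel !inE eqxx /= ltxx.
    by rewrite move_to_front_gt0 sk.
  have [->|jm] := eqVneq j m.
    rewrite /Delta_rel !inE (negbTE im) eqxx /=; case: (i \in V) => //=.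
    by rewrite (lt_gtF (p_least im)).
  by rewrite r12// move_to_front_lt ?sk//; exact: rs.
have smk : s m = k.
  apply/eqP; apply: contraT => smk; pose j := (s^-1)%g k.
  have jm : j != m by apply: contra smk => /eqP <-; rewrite permKV.
  have := rs m j; rewrite !permM permKV move_to_front_at ltn0; apply.
  by rewrite /Delta_rel !inE eqxx (negbTE jm) /= p_least ?implybT.
have lt_s i j : i != m -> j != m -> Delta_rel p q V i j -> (s i < s j)%N.
  by move=> im jm; rewrite -r12// => /rs; rewrite !permM move_to_front_lt ?sk.
(* V and the elements other than m outside V occupy separate ranges of
   positions; counting them shows that k separates these ranges. *)
have V_lt i j : i \in V -> j \notin V -> j != m -> (s i < s j)%N.
  move=> iV jV jm; apply: lt_s => //; last by rewrite /Delta_rel iV (negbTE jV).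
  by apply: contraNneq mV => <-.
move=> i j; have [->|im] := eqVneq i m; last have [->|jm] := eqVneq j m.
- rewrite /Delta_rel (negbTE mV) => /andP[jV mj].
  have jm : j != m by apply: contraTneq mj => ->; rewrite ltxx.
  rewrite smk ltn_neqAle eq_sym; apply/andP; split.
    by have := sk _ jm smk; rewrite -(inj_eq val_inj).
  rewrite -(card_perm_lt s j); apply: subset_leq_card.
  by apply/fintype.subsetP => l lV; rewrite inE V_lt.
- rewrite /Delta_rel (negbTE mV) /= => imr.
  have iV : i \in V.
    by move: imr; case: ifP => // _; rewrite (lt_gtF (q_least im)).
  rewrite smk ltn_neqAle; apply/andP; split.
    by have := sk _ im smk; rewrite -(inj_eq val_inj).
  rewrite -(card_perm_lt s i); apply: (@leq_trans #|(m |: (V :\ i))%SET|).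
    apply: subset_leq_card; apply/fintype.subsetP => l; rewrite !inE => li.
    have [//|lm] := eqVneq l m; apply/andP; split.
      by apply: contraTneq li => ->; rewrite ltnn.
    by apply: contraTT li => lV; rewrite -leqNgt ltnW// V_lt.
  rewrite cardsU1 [X in (_ <= X)%N](cardsD1 i) iV leq_add2r.
  by case: (_ \notin _).
- exact: lt_s.
Qed.

End MoveLeast.
End CountingExtensions.

(** * Sum over the subsets *)

Section LabelLeast.
Context (d : nat) (disp : Order.disp_t) (P : finPOrderType disp).
Variable p : 'I_d -> P.
Hypothesis p_bij : bijective p.

Lemma label_least_max : label_least p ord_max = inl ord0.
Proof. by rewrite /label_least unlift_none. Qed.

Lemma label_least_lift i : label_least p (lift ord_max i) = inr (p i).
Proof. by rewrite /label_least liftK. Qed.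

Lemma label_least_bij : bijective (label_least p).
Proof.
apply: inj_card_bij; last first.
  by rewrite card_sum !card_ord -(bij_eq_card p_bij) card_ord.
move=> i j; case: (unliftP ord_max i) => [i' ->|->];
  case: (unliftP ord_max j) => [j' ->|->];
  rewrite ?label_least_max ?label_least_lift //.
by move=> [/(bij_inj p_bij) ->].
Qed.

Lemma label_least_lt i j : (label_least p (lift ord_max i) <
  label_least p (lift ord_max j))%O = (p i < p j)%O.
Proof. by rewrite !label_least_lift !lt_neqAle. Qed.

Lemma label_least_least i : i != ord_max ->
  (label_least p ord_max < label_least p i)%O.
Proof.
case: (unliftP ord_max i) => [j ->|->]; last by rewrite eqxx.
by rewrite label_least_max label_least_lift.
Qed.

End LabelLeast.

Section Assembly.
Context (R : realType) (d : nat) (dispP dispQ : Order.disp_t).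
Context (P : finPOrderType dispP) (Q : finPOrderType dispQ).
Variables (p : 'I_d -> P) (q : 'I_d -> Q).
Hypotheses (p_bij : bijective p) (q_bij : bijective q).
Local Notation mu := (lebesgue_tuple R).
Local Notation e W :=
  (num_linear_extensions (Delta (label_least p) (label_least q) W)).

Definition old_labels (W : {set 'I_d}) : {set 'I_d.+1} :=
  (lift ord_max @: W)%SET.

Lemma mem_old_labels W i : (lift ord_max i \in old_labels W) = (i \in W).
Proof. by rewrite mem_imset//; exact: lift_inj. Qed.

Lemma max_notin_old_labels W : ord_max \notin old_labels W.
Proof. by apply/imsetP => -[i _ /eqP]; rewrite (negbTE (neq_lift _ _)). Qed.

Let cast : 'I_(d + 1) -> 'I_d.+1 := cast_ord (addn1 d).

Lemma cast_lshift i : cast (lshift 1 i) = lift ord_max i.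
Proof. by apply: val_inj; rewrite /= /bump leqNgt ltn_ord. Qed.

Lemma cast_rshift : cast (rshift d ord0) = ord_max.
Proof. by apply: val_inj; rewrite /= addn0. Qed.

Lemma lebesgue_region_Delta W :
  mu (d + 1) (region p q W) = ((e (old_labels W))%:R / d.+1`!%:R)%:E.
Proof.
have lp := label_least_bij p_bij; have lq := label_least_bij q_bij.
pose r (i j : 'I_(d + 1)) :=
  Delta_rel (label_least p) (label_least q) (old_labels W) (cast i) (cast j).
rewrite (@lebesgue_region _ _ _ _ _ _ _ _ (bij_inj p_bij) W r).
- have -> : (d + 1)`! = d.+1`! by rewrite addn1.
  congr (_%:R / _)%:E.
  rewrite (@num_linear_extensionsE _ _ _
    (Delta_label (label_least p) (label_least q) (old_labels W) \o cast)).
    congr #|pred_of_set _|; apply/setP => s.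
    by apply/extensionsP/extensionsP => sr i j; have := sr i j;
      rewrite /r /= Delta_label_lt.
  apply: bij_comp; first exact: Delta_label_bij.
  by exists (cast_ord (esym (addn1 d))); [exact: cast_ordK | exact: cast_ordKV].
- move=> i j; rewrite /r !cast_lshift /Delta_rel !mem_old_labels.
  by rewrite !label_least_lt.
- move=> i; rewrite /r cast_lshift cast_rshift /Delta_rel mem_old_labels.
  rewrite (negbTE (max_notin_old_labels W)); case: (i \in W) => //=.
  by rewrite (lt_gtF (label_least_least _ _)) 1?eq_sym ?neq_lift.
- move=> j; rewrite /r cast_lshift cast_rshift /Delta_rel mem_old_labels.
  rewrite (negbTE (max_notin_old_labels W)).
  by rewrite label_least_least ?andbT 1?eq_sym ?neq_lift.
- by rewrite /r cast_rshift /Delta_rel (negbTE (max_notin_old_labels W)) ltxx.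
Qed.

Lemma e_add_least W : e (ord_max |: old_labels W)%SET = e (old_labels W).
Proof.
have lp := label_least_bij p_bij; have lq := label_least_bij q_bij.
rewrite !num_linear_extensions_Delta//.
rewrite (card_extensions_move (max_notin_old_labels W))// => i;
  exact: label_least_least.
Qed.

(** Subsets of [d+1] are paired by adding or removing d+1. *)
Lemma sum_over_old_labels (F : {set 'I_d.+1} -> R) :
  \sum_(V : {set 'I_d.+1}) F V =
  \sum_(W : {set 'I_d}) (F (old_labels W) + F (ord_max |: old_labels W)%SET).
Proof.
rewrite (bigID (fun V : {set 'I_d.+1} => ord_max \in V)) /= addrC big_split /=.
pose new (V : {set 'I_d.+1}) : {set 'I_d} := (lift ord_max @^-1: V)%SET.
have newK (V : {set 'I_d.+1}) : (old_labels (new V) = V :\ ord_max)%SET.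
  apply/setP => i; rewrite !inE; case: (unliftP ord_max i) => [j ->|->].
    by rewrite mem_old_labels inE eq_sym neq_lift.
  by rewrite eqxx (negbTE (max_notin_old_labels _)).
have oldK W : new (old_labels W) = W.
  by apply/setP => i; rewrite inE mem_old_labels.
congr (_ + _).
  rewrite (reindex_onto old_labels new) /=.
    by apply: eq_bigl => W; rewrite max_notin_old_labels oldK eqxx.
  by move=> V mV; rewrite newK; apply/setP => i; rewrite !inE;
    case: eqVneq => // ->; rewrite (negbTE mV).
rewrite (reindex_onto (fun W => ord_max |: old_labels W)%SET new) /=.
  apply: eq_bigl => W; rewrite setU11 /=; apply/eqP/setP => i.
  by rewrite !inE mem_old_labels eq_sym (negbTE (neq_lift _ _)).
by move=> V mV; rewrite newK finset.setD1K.
Qed.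

Lemma vol_Omega : vol (Omega (order_polytope R p) (chain_polytope R q)) =
  (\sum_(V : {set 'I_d.+1}) (e V)%:R / (d.+1)`!%:R)%:E.
Proof.
transitivity (mu (d + 1) [set t | exists2 W, true & piece p q W t]).
  rewrite /vol; congr (mu _ _); apply/seteqP; split=> t /=.
    move/OmegaE; rewrite (_ : base _ = low t); last first.
      by apply/funext => i; rewrite /base mxE.
    rewrite /height mxE => ot.
    by exists (peaks p (low t)).
  move=> [W _ [ot _]]; apply/OmegaE; rewrite (_ : base _ = low t); last first.
    by apply/funext => i; rewrite /base mxE.
  by rewrite /height mxE.
have pieceP W := @lebesgue_piece R _ _ _ _ _ p q (bij_inj q_bij) W.
rewrite measure_finType_disjoint; last 2 first.
- by move=> W _; have [] := pieceP W.
- by move=> W W' t _ _ [_ <-] [_ <-].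
transitivity (\sum_(W : {set 'I_d})
    (2 * ((e (old_labels W))%:R / d.+1`!%:R) : R)%R%:E)%E.
  apply: eq_bigr => W _; apply: etrans (pieceP W).2 _.
  by rewrite lebesgue_region_Delta.
rewrite sumEFin sum_over_old_labels; congr (_%:E); apply: eq_bigr => W _.
by rewrite e_add_least mulrDl mul1r.
Qed.

End Assembly.

Unset Implicit Arguments.

Theorem theorem3p2 (R : realType) (d : nat) (d_ge1 : (1 <= d)%N)
    (dispP dispQ : Order.disp_t)
    (P : finPOrderType dispP) (Q : finPOrderType dispQ)
    (p : 'I_d -> P) (q : 'I_d -> Q)
    (p_bij : bijective p) (q_bij : bijective q)
    (common : common_linear_extension p q) :
  vol (Omega (order_polytope R p) (chain_polytope R q)) =
  (\sum_(W : {set 'I_d.+1})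
     (num_linear_extensions (Delta (label_least p) (label_least q) W))%:R
       / (d.+1)`!%:R)%:E.
Proof. exact: vol_Omega. Qed.
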